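(* Let $m\ge 1$, $1\le p<\infty$, and let $U\subset F_B(\mathbb{R}^m)^p$. Then $U$ is compact in $(F_B(\mathbb{R}^m)^p, d_p)$ if and only if (i) $U$ is uniformly $p$-mean bounded; (ii) $U$ is $p$-mean equi-left-continuous; and (iii) $U$ is a closed set in $(F_B(\mathbb{R}^m)^p, d_p)$.
   Context: $H$ is the Hausdorff metric on nonempty closed subsets of $\mathbb{R}^m$ (Euclidean distance): $H(A,B)=\max\{\sup_{a\in A}\inf_{b\in B}d(a,b),\ \sup_{b\in B}\inf_{a\in A}d(a,b)\}$ (possibly $+\infty$). A fuzzy set on $\mathbb{R}^m$ is a function $u:\mathbb{R}^m\to[0,1]$; its cuts are $[u]_\alpha=\{x: u(x)\ge\alpha\}$ for $\alpha\in(0,1]$ and $[u]_0=\overline{\{x: u(x)>0\}}$. $F_B(\mathbb{R}^m)^p$ is the set of fuzzy sets $u$ on $\mathbb{R}^m$ that are normal ($u(x_0)=1$ for some $x_0$), upper semi-continuous, and satisfy $\left(\int_0^1 H([u]_\alpha,\{0\})^p\,d\alpha\right)^{1/p}<+\infty$, where $0$ is the origin. The metric is $d_p(u,v)=\left(\int_0^1 H([u]_\alpha,[v]_\alpha)^p\,d\alpha\right)^{1/p}$. A set $U\subset F_B(\mathbb{R}^m)^p$ is uniformly $p$-mean bounded if there is $M>0$ with $d_p(u,\widehat{0})\le M$ for all $u\in U$, where $\widehat 0$ is the characteristic function of $\{0\}$. $U$ is $p$-mean equi-left-continuous if for every $\varepsilon>0$ there is $\delta>0$ such that for all $0\le h<\delta$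 and all $u\in U$, $\left(\int_h^1 H([u]_\alpha,[u]_{\alpha-h})^p\,d\alpha\right)^{1/p}<\varepsilon$. *)

(* Defs.v *)
From HB Require Import structures.
From mathcomp Require Import all_boot all_order all_algebra.
From mathcomp Require Import all_classical all_reals all_analysis.

Set Implicit Arguments.
Unset Strict Implicit.
Unset Printing Implicit Defensive.

Import Order.TTheory GRing.Theory Num.Theory.
Import numFieldNormedType.Exports.

Local Open Scope classical_set_scope.
Local Open Scope ring_scope.

(* The library's norm on ['rV[R]_m] is the sup norm, so the Euclidean distance
   is introduced separately.  Both induce the library topology of ['rV[R]_m],
   which is the one used below for closures and semicontinuity. *)
Definition edist {R : realType} {m : nat} (x y : 'rV[R]_m) : R :=
  Num.sqrt (\sum_(i < m) (x ord0 i - y ord0 i) ^+ 2).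

(* Meaningful for nonempty sets; takes values in [0, +oo]. *)
Definition hausdorff {R : realType} {m : nat} (A B : set 'rV[R]_m) : \bar R :=
  maxe
    (ereal_sup [set ereal_inf [set (edist a b)%:E | b in B] | a in A])
    (ereal_sup [set ereal_inf [set (edist a b)%:E | a in A] | b in B]).

(* Only levels in [0, 1] are meaningful. *)
Definition fuzzy_cut {R : realType} {m : nat} (u : 'rV[R]_m -> R) (alpha : R) :
    set 'rV[R]_m :=
  if alpha == 0 then closure [set x | 0 < u x] else [set x | alpha <= u x].

Definition upper_semicontinuous {R : realType} {T : topologicalType}
    (u : T -> R) : Prop :=
  forall x a, u x < a -> \forall y \near x, u y < a.

Definition dp {R : realType} {m : nat} (p : R) (u v : 'rV[R]_m -> R) : \bar R :=
  ((\int[lebesgue_measure]_(alpha in `[0%R, 1%R])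
      (hausdorff (fuzzy_cut u alpha) (fuzzy_cut v alpha) `^ p)) `^ p^-1)%E.

(* The set F_B(R^m)^p, as a type. *)
Record FBp (R : realType) (m : nat) (p : R) := MkFBp {
  FBp_fun :> 'rV[R]_m -> R;
  FBp_itv : forall x, 0 <= FBp_fun x <= 1;
  FBp_normal : exists x0, FBp_fun x0 = 1;
  FBp_usc : upper_semicontinuous FBp_fun;
  FBp_Lp : (((\int[lebesgue_measure]_(alpha in `[0%R, 1%R])
               (hausdorff (fuzzy_cut FBp_fun alpha) [set 0%R] `^ p)) `^ p^-1)
            < +oo)%E }.

Section FBp_topology.
Context {R : realType} {m : nat} {p : R}.
Local Notation F := (FBp m p).

HB.instance Definition _ := gen_eqMixin F.
HB.instance Definition _ := gen_choiceMixin F.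

(* The topology induced by [dp]: the open sets are those that contain a
   [dp]-ball around each of their points. *)
Definition dp_open (A : set F) : Prop :=
  forall u, A u -> exists2 e : R, 0 < e &
    forall v : F, (dp p u v < e%:E)%E -> A v.

Lemma dp_openT : dp_open setT.
Proof. by move=> u _; exists 1. Qed.

Lemma dp_openI (A B : set F) : dp_open A -> dp_open B -> dp_open (A `&` B).
Proof.
move=> oA oB u [/oA[e e0 eA] /oB[d d0 dB]].
exists (Num.min e d); first by rewrite lt_min e0 d0.
by move=> v; rewrite EFin_min lt_min => /andP[/eA Av /dB Bv].
Qed.

Lemma dp_open_bigU (I : Type) (f : I -> set F) :
  (forall i, dp_open (f i)) -> dp_open (\bigcup_i f i).
Proof.
by move=> of_ u [i _ /of_[e e0 ef]]; exists e => // v /ef fv; exists i.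
Qed.

HB.instance Definition _ :=
  isOpenTopological.Build F dp_openT dp_openI dp_open_bigU.

End FBp_topology.

Definition p_mean_bounded {R : realType} {m : nat} {p : R}
    (U : set (FBp m p)) : Prop :=
  exists2 M : R, 0 < M &
    forall u, U u -> (dp p u (\1_[set 0%R] : 'rV[R]_m -> R) <= M%:E)%E.

Definition p_mean_equi_left_continuous {R : realType} {m : nat} {p : R}
    (U : set (FBp m p)) : Prop :=
  forall eps : R, 0 < eps -> exists2 delta : R, 0 < delta &
    forall h : R, 0 <= h < delta -> forall u, U u ->
      (((\int[lebesgue_measure]_(alpha in `[h, 1%R])
           (hausdorff (fuzzy_cut u alpha) (fuzzy_cut u (alpha - h)%R) `^ p)) `^ p^-1)
       < eps%:E)%E.

(* Main.v *)
Require Import Defs.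
From HB Require Import structures.
From mathcomp Require Import all_boot all_order all_algebra.
From mathcomp Require Import all_classical all_reals all_analysis.
From mathcomp Require Import measurable_realfun lra ring.
(* [all_analysis] also defines an [edist]; this restores the Euclidean one. *)
Import Defs.

Set Implicit Arguments.
Unset Strict Implicit.
Unset Printing Implicit Defensive.

Import Order.TTheory GRing.Theory Num.Theory.
Import numFieldNormedType.Exports.
Local Open Scope classical_set_scope.
Local Open Scope ring_scope.

(* A compact [U] is bounded and equi-left-continuous by a covering argument,
   since each single [u] is left-continuous in p-mean (dominated convergence away
   from level [0], integrability near it).

   Conversely let [F] be an ultrafilter on [U].  The cuts at a level [a > 0] lie
   in a fixed ball, so they converge along [F] to a compact set [K a], and
   [K] is monotone; the limit [w] is the fuzzy set with cuts [\bigcap_(b < a) K b].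
   If [u] and [K] are [e]-close at the multiples of [s / 2], then sandwiching
   each cut between neighbouring grid levels gives, for [a > s],
     [H(u_a, w_a) <= e + H(u_a, u_(a-s)) + H(w_a, w_(a-s))],
   and the last two terms have small p-mean.  Levels near [0] are controlled
   uniformly on [U] by comparing [u_a] with [u_(a+s)].  Hence [F] converges to
   [w], and [w] lies in [U] because [U] is closed. *)

(** Two obstacles shape the proof. The cut of [w] at a level may exceed the limit of the cuts there,
    because the passage to the limit need not respect left-continuity in the level. An error in
    position is therefore traded for a shift of the level, and equi-left-continuity bounds the
    p-mean cost of such a shift. Secondly, the fixed balls come from Chebyshev's inequality: the
    radius of [u_a] decreases in [a], so a p-mean bound [M] forces it below [M / a^(1/p)]. The p-th
    power of this is [M^p / a], which is not integrable at [0], so domination by it is useless near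
    [0] and low levels need an argument of their own. The function [a |-> H(u_a, v_a)] need not be
    monotone; its measurability comes from lower semicontinuity from the left. Level [0], where the
    cut is a closure, is a null set and is dropped early, so that the work takes place on []0, 1]].
    An ultrafilter settles all levels simultaneously, which replaces a diagonal choice of
    subsequences. *)

(** * Euclidean distance and the topology of row vectors *)

Section euclidean_distance.
Context {R : realType} {m : nat}.
Implicit Types x y z : 'rV[R]_m.

Lemma edist_ge0 x y : 0 <= edist x y.
Proof. exact: sqrtr_ge0. Qed.

Lemma edistxx x : edist x x = 0.
Proof.
rewrite /edist big1 ?sqrtr0// => i _; by rewrite subrr expr0n.
Qed.

Lemma edistC x y : edist x y = edist y x.
Proof. by congr Num.sqrt; apply: eq_bigr => i _; rewrite -sqrrN opprB. Qed.

(** The sum of the squares of [B * a i - C * b i] expands to [B * (A * B - C ^+ 2)]; one divides by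
    [B], unless [B = 0] and all [b i] vanish. *)
Lemma cauchy_schwarz_sum (a b : 'I_m -> R) :
  \sum_i a i * b i <= Num.sqrt (\sum_i a i ^+ 2) * Num.sqrt (\sum_i b i ^+ 2).
Proof.
have sq_ge0 (c : 'I_m -> R) : 0 <= \sum_i c i ^+ 2.
  by apply: sumr_ge0 => i _; exact: sqr_ge0.
set A := \sum_i a i ^+ 2; set B := \sum_i b i ^+ 2; set C := \sum_i _.
rewrite -sqrtrM; last exact: sq_ge0.
have [C0|C0] := leP C 0; first exact: le_trans C0 (sqrtr_ge0 _).
rewrite -(ger0_norm (ltW C0)) -sqrtr_sqr; apply: ler_wsqrtr.
have expand : 0 <= B * (A * B - C ^+ 2).
  have -> : B * (A * B - C ^+ 2) = \sum_i (B * a i - C * b i) ^+ 2.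
    under eq_bigr do rewrite sqrrB !exprMn.
    rewrite big_split sumrB /= -!mulr_sumr -/A -/B.
    have -> : \sum_i B * a i * (C * b i) *+ 2 = 2 * (B * C) * C.
      rewrite {3}/C mulr_sumr; apply: eq_bigr => i _; ring.
    by ring.
  exact: sq_ge0.
have [B0|B0] := eqVneq B 0.
  have b0 i : b i = 0.
    apply/eqP; rewrite -sqrf_eq0; apply/eqP.
    by apply: (psumr_eq0P _ B0) => // j _; exact: sqr_ge0.
  by move: C0; rewrite /C big1 ?ltxx// => i _; rewrite b0 mulr0.
by move: expand; rewrite pmulr_rge0 ?subr_ge0// lt0r B0; exact: sq_ge0.
Qed.

Lemma edist_triangle y x z : edist x z <= edist x y + edist y z.
Proof.
pose a (i : 'I_m) := x ord0 i - y ord0 i; pose b (i : 'I_m) := y ord0 i - z ord0 i.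
have := cauchy_schwarz_sum a b; rewrite -/(edist x y) -/(edist y z) => cs.
rewrite -[leRHS]ger0_norm ?addr_ge0 ?edist_ge0// -sqrtr_sqr.
apply: ler_wsqrtr; rewrite sqrrD !sqr_sqrtr ?sumr_ge0//; last 2 first.
- by move=> i _; exact: sqr_ge0.
- by move=> i _; exact: sqr_ge0.
rewrite [leLHS](_ : _ =
    \sum_i a i ^+ 2 + (\sum_i a i * b i) *+ 2 + \sum_i b i ^+ 2); last first.
  rewrite -sumrMnl -!big_split /=; apply: eq_bigr => i _; rewrite /a /b; ring.
by rewrite lerD2r lerD2l lerMn2r.
Qed.

Lemma edist_lt_triangle y x z r s :
  edist x y < r -> edist y z < s -> edist x z < r + s.
Proof. by move=> xy yz; rewrite (le_lt_trans (edist_triangle y x z))// ltrD. Qed.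

Lemma near_edist x e : 0 < e -> \forall y \near x, edist x y < e.
Proof.
(* The summand [1] keeps the divisor positive also for [m = 0]. *)
move=> e0; have c0 : 0 < 1 + Num.sqrt (m%:R : R) by rewrite ltr_wpDr ?sqrtr_ge0.
suff edist_le y : edist x y <= Num.sqrt m%:R * `|x - y|.
  near=> y; apply: le_lt_trans (edist_le y) _.
  have : `|x - y| < e / (1 + Num.sqrt m%:R).
    by near: y; apply: cvgr_dist_lt; rewrite ?divr_gt0//; exact: cvg_id.
  rewrite ltr_pdivlMr// mulrC; apply: le_lt_trans.
  by rewrite ler_wpM2r// lerDr.
rewrite -[`|x - y|]ger0_norm// -sqrtr_sqr -sqrtrM// ler_wsqrtr//.
rewrite mulr_natl -[X in _ *+ X]card_ord -sumr_const; apply: ler_sum => i _.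
rewrite -real_normK ?num_real// lerXn2r ?nnegrE//.
rewrite {2}/Num.norm/= mx_normrE.
have -> : x ord0 i - y ord0 i = (x - y) ord0 i by rewrite !mxE.
by apply/bigmax_geP; right => /=; exists (ord0, i).
Unshelve. all: by end_near. Qed.

Lemma nbhs_edist x (A : set 'rV[R]_m) : nbhs x A ->
  exists2 e, 0 < e & forall y, edist x y < e -> A y.
Proof.
move=> /nbhs_normP[e /= e0 eA]; exists e => // y xy; apply: eA => /=.
apply: le_lt_trans xy; rewrite {1}/Num.norm/= mx_normrE.
apply: bigmax_le; first exact: edist_ge0.
move=> -[i j] _ /=; rewrite ord1 -sqrtr_sqr; apply: ler_wsqrtr.
by rewrite (bigD1 j)//= !mxE lerDl sumr_ge0// => k _; exact: sqr_ge0.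
Qed.

Lemma norm_le_edist0 x : `|x| <= edist x 0.
Proof.
rewrite /Num.norm/= mx_normrE; apply: bigmax_le; first exact: edist_ge0.
move=> -[i j] _ /=; rewrite ord1 -sqrtr_sqr; apply: ler_wsqrtr.
by rewrite (bigD1 j)//= mxE subr0 lerDl sumr_ge0// => k _; exact: sqr_ge0.
Qed.

Lemma closed_edist (A : set 'rV[R]_m) :
  (forall x, ~ A x -> exists2 e, 0 < e & forall y, edist x y < e -> ~ A y) ->
  closed A.
Proof.
move=> Ao; rewrite -openC openE => x /Ao[e e0 xe] /=.
by apply: filterS (near_edist x e0) => y /xe.
Qed.

Lemma edist_ball_closed x r : closed [set y | edist y x <= r].
Proof.
apply: closed_edist => y /negP; rewrite -ltNge => ry.
exists (edist y x - r); first by rewrite subr_gt0.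
move=> z yz /= zx; have := edist_triangle z y x; lra.
Qed.

Lemma edist_bounded_compact (A : set 'rV[R]_m) r :
  closed A -> (forall y, A y -> edist y 0 <= r) -> compact A.
Proof.
move=> Ac Ar; apply: bounded_closed_compact => //.
exists r; split; first exact: num_real.
by move=> M rM y Ay /=; rewrite (le_trans (norm_le_edist0 _))// (le_trans (Ar _ Ay))// ltW.
Qed.

End euclidean_distance.

(** * Hausdorff distance of nonempty bounded sets *)

Section hausdorff_distance.
Context {R : realType} {m : nat}.
Implicit Types A B C : set 'rV[R]_m.

Definition nonempty_bounded A :=
  A !=set0 /\ exists r, forall x, A x -> edist x 0 <= r.

(* The margin [e] is there because distances to a set need not be attained. *)
Definition within_dist A B (r : R) :=
  forall a, A a -> forall e, 0 < e -> exists2 b, B b & edist a b < r + e.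

(** [fine] sends [+oo] to the default [0], so [hd] is the distance only where that is finite, as
    [hdE] ensures for nonempty bounded sets. *)
Definition hd A B : R := fine (hausdorff A B).

Lemma within_dist_trans B A C r s :
  within_dist A B r -> within_dist B C s -> within_dist A C (r + s).
Proof.
move=> AB BC a /AB{}AB e e0; have e20 : 0 < e / 2 by rewrite divr_gt0.
have [b /BC/(_ _ e20)[c Cc bc] ab] := AB _ e20; exists c => //.
have := edist_lt_triangle ab bc; lra.
Qed.

Lemma within_dist_sub A B r : 0 <= r -> A `<=` B -> within_dist A B r.
Proof. by move=> r0 AB a /AB Ba e e0; exists a => //; rewrite edistxx; lra. Qed.

Lemma within_distS A A' B B' r : A `<=` A' -> B' `<=` B ->
  within_dist A' B' r -> within_dist A B r.
Proof.
by move=> AA' BB' AB a /AA'/AB{}AB e /AB[b /BB' Bb ab]; exists b.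
Qed.

Lemma within_dist_le A B r s : r <= s -> within_dist A B r -> within_dist A B s.
Proof.
move=> rs AB a /AB{}AB e /AB[b Bb ab]; exists b => //.
by rewrite (lt_le_trans ab)// lerD2r.
Qed.

Let excess A B := ereal_sup [set ereal_inf [set (edist a b)%:E | b in B] | a in A].

Lemma excess_le A B r : (excess A B <= r%:E)%E <-> within_dist A B r.
Proof.
split=> [ABr a Aa e e0|AB].
  have : (ereal_inf [set (edist a b)%:E | b in B] < (r + e)%:E)%E.
    apply: le_lt_trans (_ : r%:E < _)%E; last by rewrite lte_fin ltrDl.
    by apply: le_trans ABr; apply: ereal_sup_ubound; exists a.
  by move=> /ereal_inf_lt[_ [b Bb <-]]; rewrite lte_fin => ab; exists b.
apply: ge_ereal_sup => _ [a Aa <-]; apply/lee_addgt0Pr => e e0.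
have [b Bb ab] := AB a Aa e e0.
apply: le_trans (ereal_inf_lbound _) (_ : (edist a b)%:E <= _)%E; first by exists b.
by rewrite -EFinD lee_fin ltW.
Qed.

Lemma hausdorffE A B : hausdorff A B = maxe (excess A B) (excess B A).
Proof.
rewrite /hausdorff; congr maxe; congr ereal_sup; apply: eq_imagel => b _.
by congr ereal_inf; apply: eq_imagel => a _; rewrite edistC.
Qed.

Lemma hausdorffC A B : hausdorff A B = hausdorff B A.
Proof. by rewrite !hausdorffE maxC. Qed.

Lemma hdC A B : hd A B = hd B A. Proof. by rewrite /hd hausdorffC. Qed.

Lemma hausdorff_le A B r :
  (hausdorff A B <= r%:E)%E <-> within_dist A B r /\ within_dist B A r.
Proof.
rewrite hausdorffE ge_max; split.
  by move=> /andP[/excess_le ? /excess_le].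
by move=> [/excess_le -> /excess_le ->].
Qed.

Lemma nonempty_bounded_within A B : nonempty_bounded A -> nonempty_bounded B ->
  exists r, within_dist A B r.
Proof.
move=> [_ [r Ar]] [[b Bb] _]; exists (r + edist 0 b) => a /Ar a0 e e0.
exists b => //; have := edist_triangle 0 a b; lra.
Qed.

Lemma excess_ge0 A B : A !=set0 -> (0 <= excess A B)%E.
Proof.
move=> [a Aa]; apply: le_trans (_ : ereal_inf [set (edist a b)%:E | b in B] <= _)%E.
  by apply: le_ereal_inf_tmp => _ [b _ <-]; rewrite lee_fin edist_ge0.
by apply: ereal_sup_ubound; exists a.
Qed.

Lemma hausdorff_ge0 A B : A !=set0 -> (0 <= hausdorff A B)%E.
Proof. by move=> A0; rewrite hausdorffE le_max excess_ge0. Qed.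

Lemma hdE A B : nonempty_bounded A -> nonempty_bounded B ->
  hausdorff A B = (hd A B)%:E.
Proof.
move=> nA nB; rewrite /hd fineK// ge0_fin_numE; last exact: hausdorff_ge0 nA.1.
have [r AB] := nonempty_bounded_within nA nB.
have [s BA] := nonempty_bounded_within nB nA.
apply: le_lt_trans (ltry (Num.max r s)); apply/hausdorff_le.
by split; [apply: within_dist_le AB|apply: within_dist_le BA];
  rewrite le_max lexx ?orbT.
Qed.

Lemma hd_le A B r : nonempty_bounded A -> nonempty_bounded B ->
  hd A B <= r <-> within_dist A B r /\ within_dist B A r.
Proof. by move=> nA nB; rewrite -lee_fin -hdE//; exact: hausdorff_le. Qed.

Lemma hd_within A B : nonempty_bounded A -> nonempty_bounded B ->
  within_dist A B (hd A B).
Proof. by move=> nA nB; have /(hd_le _ nA nB)[] := lexx (hd A B). Qed.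

Lemma hd_ge0 A B : nonempty_bounded A -> 0 <= hd A B.
Proof. by move=> [A0 _]; rewrite fine_ge0// hausdorff_ge0. Qed.

Lemma hd_triangle B A C : nonempty_bounded A -> nonempty_bounded B ->
  nonempty_bounded C -> hd A C <= hd A B + hd B C.
Proof.
move=> nA nB nC; apply/hd_le => //; split; last rewrite addrC hdC [X in _ + X]hdC;
  by apply: within_dist_trans (hd_within _ _) (hd_within _ _).
Qed.

(** For nested sets only the excess of the larger over the smaller counts, and it grows with the
    larger set. *)
Lemma hd_subset A B C : nonempty_bounded A -> nonempty_bounded B ->
  nonempty_bounded C -> A `<=` B -> B `<=` C -> hd A B <= hd A C.
Proof.
move=> nA nB nC AB BC; apply/hd_le => //; split.
  by apply: within_dist_sub => //; exact: hd_ge0.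
by rewrite hdC; apply: within_distS (hd_within nC nA).
Qed.

Lemma nonempty_bounded_set1 (x : 'rV[R]_m) : nonempty_bounded [set x].
Proof. by split; [exists x|exists (edist x 0) => _ ->]. Qed.

Lemma edist0_le_hd A x : nonempty_bounded A -> A x -> edist x 0 <= hd A [set 0].
Proof.
move=> nA Ax; have n0 := nonempty_bounded_set1 0.
apply/ler_addgt0Pr => e e0.
by have [_ -> /ltW] := hd_within nA n0 Ax e0.
Qed.

Lemma hd0_le A r : nonempty_bounded A -> (forall x, A x -> edist x 0 <= r) ->
  hd A [set 0] <= r.
Proof.
move=> nA Ar; have n0 := nonempty_bounded_set1 0.
apply/hd_le => //; split=> [x Ax e e0|_ -> e e0].
  by exists 0 => //; rewrite (le_lt_trans (Ar _ Ax))// ltrDl.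
have [[x Ax] _] := nA; exists x => //.
by rewrite edistC (le_lt_trans (Ar _ Ax))// ltrDl.
Qed.

End hausdorff_distance.

(** * Measurability from one-sided semicontinuity *)

Section left_open_measurability.
Context {R : realType}.

(* [S] is the countable union, over the rationals [q], of the sets of points [a]
   with [`]q, a] `<=` S], each of which is an interval. *)
Lemma left_open_measurable (S : set R) :
  (forall a, S a -> exists2 d, d < a & `]d, a] `<=` S) -> measurable S.
Proof.
move=> So.
pose T (q : rat) := [set a : R | ratr q < a /\ `]ratr q, a] `<=` S].
have -> : S = \bigcup_q T q.
  apply/seteqP; split=> [a /So[d da daS]|a [q _ [qa]]]; last first.
    by apply; rewrite /= in_itv/= qa lexx.
  have [q] := rat_in_itvoo da; rewrite in_itv/= => /andP[dq qa].
  exists q => //; split=> // b /=; rewrite in_itv/= => /andP[qb ba].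
  by apply: daS; rewrite /= in_itv/= ba (lt_trans dq qb).
apply: bigcupT_measurable_rat => q; apply: is_interval_measurable.
move=> a b [qa _] [_ bS] c /andP[ac cb]; split; first exact: lt_le_trans qa ac.
move=> x; rewrite /= in_itv/= => /andP[qx xc].
by apply: bS; rewrite /= in_itv/= qx (le_trans xc).
Qed.

(** The rays []c, +oo]] generate the Borel sets of [\bar R], and the hypothesis makes their
    preimages left-open. *)
Lemma left_lsc_measurable (f : R -> \bar R) :
  (forall a (c : R), (c%:E < f a)%E ->
    exists2 d, d < a & forall b, d < b <= a -> (c%:E < f b)%E) ->
  measurable_fun setT f.
Proof.
move=> flsc; apply: (measurability _ (ErealGenOInfty.measurableE R)).
move=> _ [_ [c ->] <-]; rewrite setTI; apply: left_open_measurable => a /=.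
rewrite in_itv/= andbT => /flsc[d da dac]; exists d => // b /=.
by rewrite !in_itv/= andbT => /dac.
Qed.

End left_open_measurability.

(** * Cuts of upper semicontinuous functions *)

Section cuts.
Context {R : realType} {m : nat}.
Implicit Types u v : 'rV[R]_m -> R.

Definition cut u a : set 'rV[R]_m := [set x | a <= u x].

Lemma cut_le u a b : a <= b -> cut u b `<=` cut u a.
Proof. by move=> ab x; exact: le_trans. Qed.

Lemma usc_cut_closed u a : upper_semicontinuous u -> closed (cut u a).
Proof.
move=> uu; rewrite -openC openE => x /negP; rewrite -ltNge => /uu.
by apply: filterS => y ya; apply/negP; rewrite -ltNge.
Qed.

(** If [u < a] on all of [K], semicontinuity and compactness give a single [d < a] with [u < d] on
    [K], against the hypothesis. *)
Lemma usc_cut_compactI u (K : set 'rV[R]_m) a : upper_semicontinuous u ->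
  compact K -> (forall d, d < a -> exists2 y, K y & d < u y) ->
  exists2 y, K y & a <= u y.
Proof.
move=> uu /compact_near_coveringP cK Kd; apply: contrapT => noty.
have Ka y : K y -> u y < a.
  by move=> Ky; rewrite ltNge; apply/negP => ay; apply: noty; exists y.
have /cK : forall x, K x -> \forall x' \near x & d \near a^'-, u x' < d.
  move=> x /Ka xa; have xm : u x < (u x + a) / 2 by lra.
  exists ([set y | u y < (u x + a) / 2], [set d | (u x + a) / 2 < d]).
    by split; [exact: uu|apply: nbhs_left_gt; lra].
  by move=> [x' d] [/= xx' xd]; exact: lt_trans xd.
move=> nK; have [d [Kd' da]] : exists d, (forall y, K y -> u y < d) /\ d < a.
  apply: (@filter_ex _ (a^'-)); near=> d; split; last by near: d; exact: nbhs_left_lt.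
  by near: d; apply: nK.
by have [y /Kd' + dy] := Kd _ da; rewrite ltNge ltW.
Unshelve. all: by end_near. Qed.

(** A bound that holds at levels accumulating at [a] from the left persists at [a]: the nearby
    points found at lower levels lie in a compact ball around [x], where [usc_cut_compactI] finds
    one at level [a]. This is the source of left lower semicontinuity of the distance between
    cuts. *)
Lemma within_dist_cut u v a r : upper_semicontinuous v ->
  (forall d, d < a -> exists2 b, d < b <= a & within_dist (cut u b) (cut v b) r) ->
  within_dist (cut u a) (cut v a) r.
Proof.
move=> uv near_a x xa e e0; have e20 : 0 < e / 2 by rewrite divr_gt0.
have [||y] := @usc_cut_compactI v [set y | edist y x <= r + e / 2] a uv.
- apply: (@edist_bounded_compact _ _ _ (r + e / 2 + edist x 0)).
    exact: edist_ball_closed.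
  by move=> y /= yx; have := edist_triangle x y 0; lra.
- move=> d /near_a[b /andP[db ba] uvb].
  have [y by_ xy] := uvb x (cut_le ba xa) _ e20.
  by exists y; [rewrite /= edistC ltW|exact: lt_le_trans db by_].
by rewrite /= edistC => yx ay; exists y => //; lra.
Qed.

Lemma measurable_hausdorff_cut u v :
  upper_semicontinuous u -> upper_semicontinuous v ->
  measurable_fun setT (fun a => hausdorff (cut u a) (cut v a)).
Proof.
move=> uu uv; apply: left_lsc_measurable => a c ca; apply: contrapT => nd.
move: ca; rewrite ltNge => /negP; apply.
have near_a d : d < a -> exists2 b, d < b <= a &
    (hausdorff (cut u b) (cut v b) <= c%:E)%E.
  move=> da; apply: contrapT => nb; apply: nd; exists d => // b dba.
  by rewrite ltNge; apply/negP => ?; apply: nb; exists b.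
apply/hausdorff_le; split; apply: within_dist_cut => // d /near_a[b dba].
  by move=> /hausdorff_le[+ _]; exists b.
by move=> /hausdorff_le[_ +]; exists b.
Qed.

Lemma measurable_hd_cut (D : set R) u v :
  upper_semicontinuous u -> upper_semicontinuous v ->
  measurable_fun D (fun a => hd (cut u a) (cut v a)).
Proof.
move=> uu uv; apply: (@measurable_funS _ _ _ _ setT) => //.
by apply: measurableT_comp => //; exact: measurable_hausdorff_cut.
Qed.

End cuts.

(** * p-means over sets of levels *)

Section Lp_norm_on.
Context {R : realType}.
Variable p : R.
Hypothesis p1 : 1 <= p.
Local Notation mu := (@lebesgue_measure R).
Implicit Types (D E : set R) (f g h k : R -> R).

Let p0 : 0 < p. Proof. exact: lt_le_trans p1. Qed.
Let p_neq0 : p != 0. Proof. by rewrite gt_eqF. Qed.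
Let pV_gt0 : 0 < p^-1. Proof. by rewrite invr_gt0. Qed.

(** This keeps the shape of [dp], without absolute value; for nonnegative [f] it is the library norm
    of the restriction ([Lp_onE]), which gives access to Minkowski's inequality. *)
Definition Lp_on D f : \bar R := ((\int[mu]_(x in D) ((f x)%:E `^ p)) `^ p^-1)%E.

Lemma Lp_on_ge0 D f : (0 <= Lp_on D f)%E. Proof. exact: poweR_ge0. Qed.

Lemma eq_Lp_on D f g : {in D, f =1 g} -> Lp_on D f = Lp_on D g.
Proof.
by move=> fg; congr (_ `^ _)%E; apply: eq_integral => x /fg ->.
Qed.

Lemma measurable_pow D f : measurable_fun D f ->
  measurable_fun D (fun x => (f x)%:E `^ p)%E.
Proof.
by move=> mf; apply: (measurableT_comp (measurable_poweR _)); exact/measurable_EFinP.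
Qed.

Lemma integral_pow_ge0 D f : (0 <= \int[mu]_(x in D) ((f x)%:E `^ p))%E.
Proof. by apply: integral_ge0 => x _; exact: poweR_ge0. Qed.

Lemma pow_Lp_on D f :
  (Lp_on D f `^ p = \int[mu]_(x in D) ((f x)%:E `^ p))%E.
Proof.
by rewrite /Lp_on -poweRrM mulVf// poweRe1//; exact: integral_pow_ge0.
Qed.

Lemma Lp_on_leP D f (c : R) : 0 <= c ->
  (Lp_on D f <= c%:E)%E <-> (\int[mu]_(x in D) ((f x)%:E `^ p) <= (c `^ p)%:E)%E.
Proof.
move=> c0; have int0 := integral_pow_ge0 D f.
rewrite -poweR_EFin; split=> [fc|fc].
  rewrite -pow_Lp_on; apply: gt0_ler_poweR => //.
  - exact: ltW.
  - by rewrite in_itv/= Lp_on_ge0 leey.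
  - by rewrite in_itv/= lee_fin c0 leey.
have -> : c%:E = ((c%:E `^ p) `^ p^-1)%E by rewrite -poweRrM mulfV// poweRe1.
apply: gt0_ler_poweR => //.
- exact: ltW.
- by rewrite in_itv/= int0 leey.
- by rewrite in_itv/= lee_fin powR_ge0 leey.
Qed.

Lemma le_Lp_on D E f g : measurable D -> measurable E -> D `<=` E ->
  measurable_fun D f -> measurable_fun E g ->
  (forall x, D x -> 0 <= f x <= g x) -> (Lp_on D f <= Lp_on E g)%E.
Proof.
move=> mD mE DE mf mg fg; apply: gt0_ler_poweR.
- exact: ltW.
- by rewrite in_itv/= leey andbT; exact: integral_pow_ge0.
- by rewrite in_itv/= leey andbT; exact: integral_pow_ge0.
apply: (@le_trans _ _ (\int[mu]_(x in D) ((g x)%:E `^ p))%E).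
  apply: ge0_le_integral => //.
  - by move=> x _; exact: poweR_ge0.
  - exact: measurable_pow.
  - by apply: measurable_pow; exact: measurable_funS mg.
  - move=> x /fg/andP[f0 fg']; rewrite !poweR_EFin lee_fin ge0_ler_powR ?nnegrE//.
      exact: ltW.
    exact: le_trans fg'.
apply: ge0_subset_integral => //; first exact: measurable_pow.
by move=> x _; exact: poweR_ge0.
Qed.

Lemma Lp_onE D f : measurable D -> (forall x, D x -> 0 <= f x) ->
  Lp_on D f = Lnorm mu p%:E (EFin \o (f \_ D)).
Proof.
move=> mD f0; rewrite unlock /Lnorm /Lp_on; congr (_ `^ _)%E.
rewrite [LHS]integral_mkcond; apply: eq_integral => x _; rewrite /= !patchE.
have [/set_mem/f0 fx|_] := boolP (x \in D); first by rewrite ger0_norm.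
by rewrite /= normr0 powR0.
Qed.

Lemma Lp_on_minkowski D f g h : measurable D ->
  measurable_fun D f -> measurable_fun D g -> measurable_fun D h ->
  (forall x, D x -> 0 <= f x) -> (forall x, D x -> 0 <= g x) ->
  (forall x, D x -> 0 <= h x <= f x + g x) ->
  (Lp_on D h <= Lp_on D f + Lp_on D g)%E.
Proof.
move=> mD mf mg mh f0 g0 hfg.
apply: (@le_trans _ _ (Lp_on D (f \+ g))).
  by apply: le_Lp_on => //; exact: measurable_funD.
rewrite !Lp_onE//; last by move=> x Dx; rewrite /= addr_ge0 ?f0 ?g0.
rewrite [X in EFin \o X](_ : _ = (f \_ D \+ g \_ D)); last first.
  by apply/funext => x; rewrite /restrict /=; case: ifPn; rewrite ?addr0.
by apply: minkowski_EFin => //; apply/(measurable_restrictT _ _).1.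
Qed.

Lemma Lp_on_minkowski3 D f g h k : measurable D -> measurable_fun D f ->
  measurable_fun D g -> measurable_fun D h -> measurable_fun D k ->
  (forall x, D x -> 0 <= f x) -> (forall x, D x -> 0 <= g x) ->
  (forall x, D x -> 0 <= h x) -> (forall x, D x -> 0 <= k x <= f x + (g x + h x)) ->
  (Lp_on D k <= Lp_on D f + (Lp_on D g + Lp_on D h))%E.
Proof.
move=> mD mf mg mh mk f0 g0 h0 kfgh.
have gh0 x : D x -> 0 <= g x + h x by move=> Dx; rewrite addr_ge0 ?g0 ?h0.
apply: (@le_trans _ _ (Lp_on D f + Lp_on D (g \+ h)%R)%E).
  by apply: Lp_on_minkowski => //; exact: measurable_funD.
rewrite leeD2l//; apply: Lp_on_minkowski => //; first exact: measurable_funD.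
by move=> x Dx; rewrite gh0//= lexx.
Qed.

(** Minkowski's inequality for the restrictions of [f] to [D] and [E], whose sum dominates [f] on
    the union. *)
Lemma Lp_on_setU D E f : measurable D -> measurable E ->
  measurable_fun (D `|` E) f -> (forall x, (D `|` E) x -> 0 <= f x) ->
  (Lp_on (D `|` E) f <= Lp_on D f + Lp_on E f)%E.
Proof.
move=> mD mE mf f0.
have mfD : measurable_fun setT (f \_ D).
  apply/(measurable_restrictT _ _).1 => //.
  by apply: measurable_funS mf; [exact: measurableU|exact: subsetUl].
have mfE : measurable_fun setT (f \_ E).
  apply/(measurable_restrictT _ _).1 => //.
  by apply: measurable_funS mf; [exact: measurableU|exact: subsetUr].
have pos A x : A `<=` D `|` E -> 0 <= (f \_ A) x.
  by move=> A0; rewrite patchE; case: ifPn => // /set_mem Ax; exact/f0/A0.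
have restr A : measurable A -> A `<=` D `|` E ->
    Lp_on (D `|` E) (f \_ A) = Lp_on A f.
  move=> mA A0; rewrite (@Lp_onE (D `|` E))//; last 2 first.
  - exact: measurableU.
  - by move=> x _; exact: pos.
  rewrite Lp_onE//; last by move=> x Ax; exact/f0/A0.
  congr Lnorm; apply/funext => x; rewrite /= !patchE.
  have [//|nDE] := boolP (x \in D `|` E); case: ifPn => // /set_mem /A0.
  by move/mem_set => DE; rewrite DE in nDE.
rewrite -(restr D)// -(restr E)//.
apply: Lp_on_minkowski => //.
- exact: measurableU.
- exact: measurable_funTS.
- exact: measurable_funTS.
- by move=> x _; exact: pos.
- by move=> x _; exact: pos.
- move=> x DEx; have f0x := f0 _ DEx; rewrite f0x/= !patchE.
  by case: DEx => DEx; [|rewrite addrC]; rewrite mem_set//; case: ifPn => _;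
    rewrite ?lerDl ?addr0.
Qed.

Lemma Lp_on_cst (a b c : R) : a <= b -> 0 <= c ->
  Lp_on `]a, b] (cst c) = (c * (b - a) `^ p^-1)%:E.
Proof.
move=> ab c0; rewrite [LHS](_ : _ =
    ((\int[mu]_(x in `]a, b]) cst (c `^ p)%:E x) `^ p^-1)%E)//.
rewrite integral_cst//= lebesgue_measure_itv/=.
rewrite lte_fin; case: ltP => [_|ba].
  rewrite -EFinD -EFinM poweR_EFin powRM ?powR_ge0 ?subr_ge0//.
  by rewrite -powRrM mulfV// powRr1.
have -> : b - a = 0 by apply/eqP; rewrite subr_eq0 eq_le ba ab.
by rewrite mule0 powR0 ?invr_neq0// mulr0 poweR0r// invr_neq0.
Qed.

(** Translation invariance follows from uniqueness of Lebesgue measure: the pushforward along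
    [x - c] gives every interval []x, y]] its length. *)
Lemma Lp_on_shift (a b c : R) f : measurable_fun `]a, b] f ->
  Lp_on `]a + c, b + c] (fun x => f (x - c)) = Lp_on `]a, b] f.
Proof.
move=> mf; congr (_ `^ _)%E.
pose phi : measurableTypeR R -> measurableTypeR R := fun x => x - c.
have mphi : measurable_fun setT phi by exact: measurable_funB.
pose phimix := isMeasurableFun.Build _ _ _ _ _ mphi.
pose phif : {mfun _ >-> _} := HB.pack phi phimix.
have phiE x y : phi @^-1` `]x, y] = `]x + c, y + c]%classic.
  by apply/seteqP; split => z; rewrite /= !in_itv/= /phi ltrBrDr lerBlDr.
have -> : `]a + c, b + c]%classic = phi @^-1` `]a, b] by rewrite phiE.
rewrite -(@ge0_integral_pushforward _ _ _ _ _ phi mphi mu _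
  (fun x => (f x)%:E `^ p)%E)//; last 2 first.
- exact: measurable_pow.
- by move=> x _; exact: poweR_ge0.
apply/esym/eq_measure_integral => A mA _.
apply: (@lebesgue_measure_unique _ (pushforward mu phif)) => //.
move=> _ [[x y] _ <-] /=; rewrite /pushforward phiE !lebesgue_measure_itv/=.
by rewrite !lte_fin ltrD2r -!EFinD opprD addrACA subrr addr0.
Qed.

(** Absolute continuity of the integral of [f ^ p], applied to []0, t]], whose measure [t] is
    small. *)
Lemma Lp_on_tail f (e : R) : measurable_fun `](0 : R), 1] f ->
  (Lp_on `]0%R, 1%R] f < +oo)%E -> 0 < e ->
  exists2 t, 0 < t <= 1 & (Lp_on `]0%R, t] f < e%:E)%E.
Proof.
move=> mf foo e0; set D := `](0 : R), 1]%classic.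
pose g := (fun x => (f x) `^ p) \_ D.
have g0 x : 0 <= g x by rewrite /g /restrict; case: ifPn => // _; exact: powR_ge0.
have mg : measurable_fun setT g.
  apply/(measurable_restrictT _ _).1; first exact: measurable_itv.
  by apply: (@measurableT_comp _ _ _ _ _ _ (@powR R ^~ p)).
have gE : (\int[mu]_x (g x)%:E = \int[mu]_(x in D) ((f x)%:E `^ p))%E.
  rewrite [RHS]integral_mkcond; apply: eq_integral => x _.
  by rewrite /= /g !patchE; have [] := boolP (x \in D).
have ig : mu.-integrable setT (EFin \o g).
  apply/integrableP; split; first exact/measurable_EFinP.
  under eq_integral do rewrite /= ger0_norm//.
  by rewrite gE -pow_Lp_on poweR_lty.
have ep : 0 < (e / 2) `^ p by rewrite powR_gt0// divr_gt0.
have [d [d0 dA]] := integral_normr_continuous ig ep.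
exists (Num.min 1 (d / 2)); first by rewrite lt_min ltr01 divr_gt0//= ge_min lexx.
set t := Num.min 1 (d / 2).
have t1 : t <= 1 by rewrite ge_min lexx.
have t0 : 0 < t by rewrite lt_min ltr01 divr_gt0.
apply: (@le_lt_trans _ _ (e / 2)%:E); last by rewrite lte_fin; lra.
apply/Lp_on_leP; first by rewrite ltW ?divr_gt0.
have mut : (mu `]0%R, t] < d%:E)%E.
  rewrite lebesgue_measure_itv/= lte_fin t0 -EFinD subr0 lte_fin.
  by rewrite (@le_lt_trans _ _ (d / 2))// ?ge_min ?lexx ?orbT//; lra.
have := dA _ (measurable_itv _) mut.
rewrite /Rintegral => /ltW; rewrite -lee_fin fineK; last first.
  rewrite ge0_fin_numE; last by apply: integral_ge0 => x _; rewrite lee_fin.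
  move/integrableP : ig => [_]; apply: le_lt_trans.
  apply: ge0_subset_integral => //.
  by apply/measurable_EFinP; exact: measurableT_comp.
apply: le_trans; rewrite le_eqVlt; apply/orP; left; apply/eqP.
apply: eq_integral => x; rewrite inE/= in_itv/= => /andP[x0 xt].
rewrite ger0_norm// /g /restrict mem_set//.
by rewrite /D /= in_itv/= x0 (le_trans xt t1).
Qed.

(** Monotone convergence along []1/(n+1), 1]]. It serves a function whose p-mean is estimated only
    above positive levels, uniformly in the level. *)
Lemma Lp_on_exhaust f (c : R) : measurable_fun `](0 : R), 1] f -> 0 <= c ->
  (forall t, 0 < t <= 1 -> (Lp_on `]t, 1%R] f <= c%:E)%E) ->
  (Lp_on `]0%R, 1%R] f <= c%:E)%E.
Proof.
move=> mf c0 fc; apply/Lp_on_leP => //.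
pose F n := `](n.+1%:R^-1 : R), 1]%classic.
have F_cover : \bigcup_n F n = `]0, 1]%classic.
  apply/seteqP; split=> [x [n _]|x]; rewrite /F /= !in_itv/= => /andP[x0 x1].
    by rewrite x1 andbT; apply: lt_trans x0; rewrite invr_gt0.
  have [n _ nx] := near_infty_natSinv_lt (PosNum x0).
  by exists n => //=; rewrite in_itv/= x1 andbT; exact: (nx n (leqnn n)).
have sub n : F n `<=` `]0, 1]%classic by rewrite -F_cover; exact: bigcup_sup.
have mfp : measurable_fun `](0 : R), 1] (fun x => (f x)%:E `^ p)%E by exact: measurable_pow.
have cvgF : (\int[mu]_(x in F n) ((f x)%:E `^ p) @[n --> \oo] -->
    \int[mu]_(x in `]0%R, 1%R]) ((f x)%:E `^ p))%E.
  rewrite -F_cover; apply: ge0_nondecreasing_set_cvg_integral.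
  - move=> i j ij; rewrite subsetEset => x; rewrite /F /= !in_itv/= => /andP[+ ->].
    by rewrite andbT; apply: le_lt_trans; rewrite lef_pV2 ?posrE// ler_nat.
  - by move=> n; exact: measurable_itv.
  - by move=> n; exact: measurable_funS mfp.
  - by move=> n x _; exact: poweR_ge0.
apply: cvge_to_le cvgF _; apply: nearW => n; apply/Lp_on_leP => //.
by apply: fc; rewrite invr_gt0 ltr0n invf_le1// ler1n.
Qed.

End Lp_norm_on.

(** * The indicator of the origin *)

Section zero_fuzzy_set.
Context {R : realType} {m : nat}.

Lemma cut_indic0 (a : R) : 0 < a <= 1 ->
  cut (\1_[set 0] : 'rV[R]_m -> R) a = [set 0].
Proof.
move=> /andP[a0 a1]; apply/seteqP; split=> x; rewrite /cut /= indicE.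
  by case: (boolP (x \in _)) => [/set_mem//|_]; rewrite leNgt a0.
by move=> ->; rewrite mem_set.
Qed.

Lemma indic0_usc : upper_semicontinuous (\1_[set 0] : 'rV[R]_m -> R).
Proof.
move=> x a; rewrite !indicE; case: (boolP (x \in _)) => [_ a1|/negP x0 a0].
  near=> y; rewrite indicE; case: (y \in _) => //.
  by apply: lt_trans a1.
have x0' : 0 < edist x 0.
  apply: lt_le_trans (norm_le_edist0 x); rewrite normr_gt0; apply/eqP => x0'.
  by apply: x0; rewrite x0' mem_set.
near=> y; rewrite indicE memNset//= => y0.
by have : edist x y < edist x 0 by [near: y; exact: near_edist]; rewrite y0 ltxx.
Unshelve. all: by end_near. Qed.

End zero_fuzzy_set.

(** * The metric [dp] *)

Section Lp_fuzzy_sets.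
Context {R : realType} {m : nat} {p : R}.
Hypothesis p1 : 1 <= p.
Local Notation mu := (@lebesgue_measure R).
Local Notation F := (FBp m p).
Implicit Types u v w : F.

Let p0 : 0 < p. Proof. exact: lt_le_trans p1. Qed.
Let p_neq0 : p != 0. Proof. by rewrite gt_eqF. Qed.

(** The endpoint [h] is a null set, so [G] is arbitrary there; this discards the closure that
    defines the cut at level [0]. *)
Lemma integral_cc_oc (h : R) (G H : R -> \bar R) : measurable_fun setT H ->
  (forall a, h < a <= 1 -> G a = H a) ->
  (\int[mu]_(a in `[h, 1%R]) (G a `^ p) = \int[mu]_(a in `]h, 1%R]) (H a `^ p))%E.
Proof.
move=> mH GH; have GHp : {in `]h, 1]%classic, (fun a => H a `^ p)%E =1 (fun a => G a `^ p)%E}.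
  by move=> a /set_mem /=; rewrite in_itv/= => /GH ->.
rewrite -integral_itv_obnd_cbnd.
  by apply: eq_integral => a /GHp.
apply: eq_measurable_fun GHp _; apply: (@measurable_funS _ _ _ _ setT) => //.
exact: (measurableT_comp (measurable_poweR _)).
Qed.

Lemma fuzzy_cutE (f : 'rV[R]_m -> R) a : 0 < a -> fuzzy_cut f a = cut f a.
Proof. by move=> a0; rewrite /fuzzy_cut gt_eqF. Qed.

Lemma dp_oc (f g : 'rV[R]_m -> R) : upper_semicontinuous f ->
  upper_semicontinuous g -> dp p f g =
  ((\int[mu]_(a in `]0%R, 1%R]) (hausdorff (cut f a) (cut g a) `^ p)) `^ p^-1)%E.
Proof.
move=> uf ug.
rewrite /dp (@integral_cc_oc 0 _ (fun a => hausdorff (cut f a) (cut g a)))//.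
  exact: measurable_hausdorff_cut.
by move=> a /andP[a0 _]; rewrite !fuzzy_cutE.
Qed.

Lemma Lp_indic0 (f : 'rV[R]_m -> R) : upper_semicontinuous f ->
  ((\int[mu]_(a in `[0%R, 1%R]) (hausdorff (fuzzy_cut f a) [set 0%R] `^ p)) `^ p^-1 =
   dp p f (\1_[set 0%R] : 'rV[R]_m -> R))%E.
Proof.
move=> uf; rewrite (dp_oc uf indic0_usc).
rewrite (@integral_cc_oc 0 _ (fun a => hausdorff (cut f a)
  (cut (\1_[set 0%R] : 'rV[R]_m -> R) a)))//.
  by apply: measurable_hausdorff_cut => //; exact: indic0_usc.
by move=> a a01; rewrite cut_indic0// fuzzy_cutE//; case/andP: a01.
Qed.

Lemma indic0_Lp : ((\int[mu]_(a in `[0%R, 1%R])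
  (hausdorff (fuzzy_cut (\1_[set 0%R] : 'rV[R]_m -> R) a) [set 0%R] `^ p)) `^ p^-1 < +oo)%E.
Proof.
rewrite (@integral_cc_oc _ _ (cst 0%E))//.
  by rewrite integral0_eq ?poweR0r ?invr_neq0// => a _; rewrite /= powR0.
move=> a a01; rewrite fuzzy_cutE ?cut_indic0//; last by case/andP: a01.
apply/eqP; rewrite eq_le hausdorff_ge0; last by exists 0.
by rewrite andbT; apply/hausdorff_le; split; exact: within_dist_sub.
Qed.

(** Packed as an element of the type so that the triangle inequality of [dp] applies to it, and
    transparent so that the distance to it is convertible with the one in [p_mean_bounded]. *)
Definition FBp0 : F.
Proof.
apply: (@MkFBp R m p (\1_[set 0])).
- by move=> x; rewrite indicE; case: (x \in _); rewrite ?lexx ?ler01.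
- by exists 0; rewrite indicE mem_set.
- exact: indic0_usc.
- exact: indic0_Lp.
Defined.

Lemma cut_FBp0 (a : R) : 0 < a <= 1 -> cut FBp0 a = [set 0].
Proof. exact: cut_indic0. Qed.

Lemma dp0_fin u : (dp p u FBp0 < +oo)%E.
Proof. by have := FBp_Lp u; rewrite Lp_indic0//; exact: FBp_usc. Qed.

(** Chebyshev's inequality: [x] lies in every cut at a level in []0, a]], so the distance to the
    origin is at least [edist x 0] there. It is proved for [hausdorff] instead of [hd] because
    boundedness of the cuts is derived from it. *)
Lemma edist0_dp u a x : 0 < a <= 1 -> cut u a x ->
  ((edist x 0 * a `^ p^-1)%:E <= dp p u FBp0)%E.
Proof.
move=> /andP[a0 a1] ax; rewrite dp_oc; [|exact: FBp_usc|exact: FBp_usc].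
rewrite -[X in _ * X `^ _]subr0 -Lp_on_cst ?edist_ge0// ?(ltW a0)//.
have mH (D : set R) :
    measurable_fun D (fun a => (hausdorff (cut u a) (cut FBp0 a) `^ p)%E).
  apply: (@measurable_funS _ _ _ _ setT) => //.
  apply: (measurableT_comp (measurable_poweR _)).
  by apply: measurable_hausdorff_cut; exact: FBp_usc.
rewrite /Lp_on; apply: gt0_ler_poweR.
- by rewrite invr_ge0 ltW.
- by rewrite in_itv/= leey andbT; exact: integral_pow_ge0.
- by rewrite in_itv/= leey andbT; apply: integral_ge0 => b _; exact: poweR_ge0.
apply: (@le_trans _ _ (\int[mu]_(b in `]0%R, a])
    (hausdorff (cut u b) (cut FBp0 b) `^ p))%E).
  apply: ge0_le_integral => //.
  - by move=> b _; exact: poweR_ge0.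
  - exact: measurable_pow.
  - exact: mH.
  move=> b /=; rewrite in_itv/= => /andP[b0 ba].
  rewrite cut_FBp0 ?b0 ?(le_trans ba)//.
  have bx : cut u b x by exact: cut_le ax.
  have H0 : (0 <= hausdorff (cut u b) [set 0%R])%E by apply: hausdorff_ge0; exists x.
  rewrite -poweR_EFin; apply: gt0_ler_poweR;
    rewrite ?in_itv/= ?leey ?lee_fin ?edist_ge0 ?H0 ?(ltW p0)//.
  apply: le_trans (_ : ereal_inf [set (edist x b)%:E | b in [set 0%R]] <= _)%E.
    by apply: le_ereal_inf_tmp => _ [_ -> <-].
  rewrite hausdorffE le_max; apply/orP; left.
  by apply: ereal_sup_ubound; exists x.
apply: ge0_subset_integral; rewrite //=.
- exact: mH.
- by move=> b _; exact: poweR_ge0.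
- by move=> b /=; rewrite !in_itv/= => /andP[-> ba]; exact: le_trans ba a1.
Qed.

Lemma FBp_cut_nonempty_bounded u a : 0 < a <= 1 -> nonempty_bounded (cut u a).
Proof.
move=> a01; have [a0 a1] := andP a01; split.
  by have [x ux] := FBp_normal u; exists x; rewrite /cut /= ux.
exists (fine (dp p u FBp0) / a `^ p^-1) => x ax.
rewrite ler_pdivlMr ?powR_gt0// -lee_fin fineK; first exact: edist0_dp ax.
by rewrite ge0_fin_numE ?dp0_fin// poweR_ge0.
Qed.

Lemma FBp_cut_compact u a : 0 < a <= 1 -> compact (cut u a).
Proof.
move=> /(FBp_cut_nonempty_bounded u)[_ [r ur]].
by apply: edist_bounded_compact ur; apply: usc_cut_closed; exact: FBp_usc.
Qed.

(** Shifting the level amounts to adding a constant to the function, which preserves upper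
    semicontinuity. *)
Lemma measurable_hd_FBp u v (D : set R) (s t : R) :
  measurable_fun D (fun a => hd (cut u (a - s)) (cut v (a - t))).
Proof.
have shift w (c a : R) : cut w (a - c) = cut (fun x => w x + c) a.
  by apply/seteqP; split => x; rewrite /cut /= lerBlDr.
under eq_fun do rewrite !shift.
have usc w (c : R) : upper_semicontinuous (fun x => w x + c).
  move=> x a; rewrite -ltrBrDr => /FBp_usc.
  by apply: filterS => y; rewrite -ltrBrDr.
exact: measurable_hd_cut.
Qed.

Definition level_dist u v a : R := hd (cut u a) (cut v a).

Lemma measurable_level_dist u v (D : set R) : measurable_fun D (level_dist u v).
Proof. by apply: measurable_hd_cut; exact: FBp_usc. Qed.

Lemma level_dist_ge0 u v a : 0 < a <= 1 -> 0 <= level_dist u v a.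
Proof. by move=> a01; apply: hd_ge0; exact: FBp_cut_nonempty_bounded. Qed.

Lemma level_dist_triangle v u w a : 0 < a <= 1 ->
  level_dist u w a <= level_dist u v a + level_dist v w a.
Proof. by move=> a01; apply: hd_triangle; exact: FBp_cut_nonempty_bounded. Qed.

Lemma level_distC u v : level_dist u v = level_dist v u.
Proof. by apply/funext => a; exact: hdC. Qed.

Lemma dpE u v : dp p u v = Lp_on p `]0, 1] (level_dist u v).
Proof.
rewrite dp_oc; [|exact: FBp_usc|exact: FBp_usc].
congr (_ `^ _)%E; apply: eq_integral => a /set_mem /=; rewrite in_itv/= => a01.
by rewrite hdE//; exact: FBp_cut_nonempty_bounded.
Qed.

Lemma dp_sym u v : dp p u v = dp p v u.
Proof. by rewrite !dpE level_distC. Qed.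

Lemma dp_triangle v u w : (dp p u w <= dp p u v + dp p v w)%E.
Proof.
rewrite !dpE; apply: Lp_on_minkowski => //; try exact: measurable_level_dist.
- by move=> a /=; rewrite in_itv/=; exact: level_dist_ge0.
- by move=> a /=; rewrite in_itv/=; exact: level_dist_ge0.
- by move=> a /=; rewrite in_itv/= => a01; rewrite level_dist_ge0// level_dist_triangle.
Qed.

Lemma dp_ge0 u v : (0 <= dp p u v)%E. Proof. exact: poweR_ge0. Qed.

Lemma dp_fin u v : (dp p u v < +oo)%E.
Proof.
apply: le_lt_trans (dp_triangle FBp0 u v) _.
by apply: lte_add_pinfty; [|rewrite dp_sym]; exact: dp0_fin.
Qed.

Lemma dpxx u : dp p u u = 0%E.
Proof.
rewrite dpE /Lp_on integral0_eq ?poweR0r ?invr_neq0// => a /=.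
rewrite in_itv/= => a01; rewrite (_ : level_dist u u a = 0) ?powR0//.
apply/le_anti/andP; split; last exact: level_dist_ge0.
by apply/hd_le; [exact: FBp_cut_nonempty_bounded..|split; exact: within_dist_sub].
Qed.

Lemma FBp_ext u v : FBp_fun u = FBp_fun v -> u = v.
Proof.
case: u v => [u ui un uu up] [v vi vn vu vp] /= uv; move: vi vn vu vp; rewrite -uv.
by move=> *; congr MkFBp; exact: Prop_irrelevance.
Qed.

(** If [z x < w x], semicontinuity gives an [e]-ball around [x] on which [z] stays below the
    midpoint [a]. At every level in []a, w x]] the point [x] is in the cut of [w] and at distance at
    least [e] from the cut of [z], which makes the integral positive. *)
Lemma dp_eq0 u v : dp p u v = 0%E -> u = v.
Proof.
suff le_of_dp0 (w z : F) x : dp p w z = 0%E -> w x <= z x.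
  move=> uv; apply/FBp_ext/funext => x; apply/le_anti/andP.
  by split; [exact: le_of_dp0 uv|apply: le_of_dp0; rewrite dp_sym].
move=> wz0; rewrite leNgt; apply/negP => zw.
have [/andP[w0 w1] /andP[z0 z1]] := (FBp_itv w x, FBp_itv z x).
pose a := (z x + w x) / 2.
have a01 : 0 < a <= 1 by rewrite /a; apply/andP; split; lra.
have [za aw] : z x < a /\ a < w x by rewrite /a; split; lra.
have [e e0 xe] : exists2 e, 0 < e & forall y, edist x y < e -> z y < a.
  by apply: nbhs_edist; exact: FBp_usc.
have : ((e * (w x - a) `^ p^-1)%:E <= 0)%E.
  rewrite -wz0 dpE -Lp_on_cst ?(ltW e0) ?(ltW aw) //; apply: le_Lp_on => //.
  - by move=> b /=; rewrite !in_itv/=; case/andP: a01 => a0 _; lra.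
  - exact: measurable_level_dist.
  move=> b /=; rewrite in_itv/= => /andP[ab bw]; rewrite ltW//=.
  have b01 : 0 < b <= 1 by case/andP: a01 => a0 _; apply/andP; split; lra.
  rewrite leNgt; apply/negP => bwe.
  pose r := (e - level_dist w z b) / 2.
  have r0 : 0 < r by rewrite /r; lra.
  have [y yz xy] := hd_within (FBp_cut_nonempty_bounded w b01)
    (FBp_cut_nonempty_bounded z b01) bw r0.
  have /xe : edist x y < e by move: xy; rewrite -/(level_dist w z b) /r; lra.
  by rewrite ltNge => /negP; apply; apply: le_trans yz; exact: ltW.
by rewrite lee_fin leNgt mulr_gt0// powR_gt0// subr_gt0.
Qed.

End Lp_fuzzy_sets.

(** * Radii of cuts and left-continuity of a single fuzzy set *)

Section left_oscillation.
Context {R : realType} {m : nat} {p : R}.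
Hypothesis p1 : 1 <= p.
Local Notation mu := (@lebesgue_measure R).
Implicit Types (u v : FBp m p) (a b h : R).

Let p0 : 0 < p. Proof. exact: lt_le_trans p1. Qed.
Let p_neq0 : p != 0. Proof. by rewrite gt_eqF. Qed.

Let FBp_cut_nb u a : 0 < a <= 1 -> nonempty_bounded (cut u a).
Proof. exact: FBp_cut_nonempty_bounded. Qed.

(** On []0, 1]] this is the supremum of the norms in the cut; written as a distance to [FBp0], its
    p-mean is [dp p u (FBp0 p1)]. *)
Definition radius u a : R := level_dist u (FBp0 p1) a.

Lemma radiusE u a : 0 < a <= 1 -> radius u a = hd (cut u a) [set 0].
Proof. by move=> a01; rewrite /radius /level_dist cut_FBp0. Qed.

Lemma radius_ge0 u a : 0 < a <= 1 -> 0 <= radius u a.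
Proof. exact: level_dist_ge0. Qed.

Lemma edist0_le_radius u a x : 0 < a <= 1 -> cut u a x -> edist x 0 <= radius u a.
Proof. by move=> a01 ax; rewrite radiusE//; exact: edist0_le_hd (FBp_cut_nb u a01) _. Qed.

Lemma radius_le u a (r : R) : 0 < a <= 1 ->
  (forall x, cut u a x -> edist x 0 <= r) -> radius u a <= r.
Proof. by move=> a01 ar; rewrite radiusE//; apply: hd0_le ar; exact: FBp_cut_nb. Qed.

Lemma radius_nonincreasing u a b : 0 < a -> a <= b <= 1 -> radius u b <= radius u a.
Proof.
move=> a0 /andP[ab b1]; apply: radius_le; first by rewrite b1 (lt_le_trans a0).
move=> x bx; apply: edist0_le_radius; first by rewrite a0 (le_trans ab).
exact: cut_le bx.
Qed.

Lemma measurable_radius u (D : set R) : measurable_fun D (radius u).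
Proof. exact: measurable_level_dist. Qed.

(** The radius is nonincreasing, hence at least [radius u a] on all of []0, a]]. *)
Lemma radius_dp u a : 0 < a <= 1 ->
  ((radius u a * a `^ p^-1)%:E <= dp p u (FBp0 p1))%E.
Proof.
move=> /[dup] a01 /andP[a0 a1].
rewrite -[X in (X `^ _)%R]subr0 -Lp_on_cst ?radius_ge0 ?(ltW a0)//.
rewrite (dpE p1); apply: le_Lp_on => //.
- by move=> b /=; rewrite !in_itv/= => /andP[-> ba]; exact: le_trans ba a1.
- exact: measurable_radius.
- move=> b /=; rewrite in_itv/= => /andP[b0 ba]; rewrite radius_ge0//=.
  by apply: radius_nonincreasing => //; rewrite ba.
Qed.

Definition left_osc u h a : R := hd (cut u a) (cut u (a - h)).

Definition Lp_left_osc u h : \bar R := Lp_on p `]h, 1] (left_osc u h).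

Lemma measurable_left_osc u h (D : set R) : measurable_fun D (left_osc u h).
Proof. by have := measurable_hd_FBp u u (D := D) 0 h; under eq_fun do rewrite subr0. Qed.

Lemma left_osc_ge0 u h a : 0 < a <= 1 -> 0 <= left_osc u h a.
Proof. by move=> a01; apply: hd_ge0; exact: FBp_cut_nb. Qed.

Lemma left_oscE u h : 0 <= h ->
  ((\int[mu]_(a in `[h, 1%R])
     (hausdorff (fuzzy_cut u a) (fuzzy_cut u (a - h)%R) `^ p)) `^ p^-1 =
   Lp_left_osc u h)%E.
Proof.
move=> h0; pose uh x := u x + h.
have cuth a : cut uh a = cut u (a - h).
  by apply/seteqP; split => x; rewrite /cut /uh /= lerBlDr.
have usch : upper_semicontinuous uh.
  move=> x a; rewrite /uh -ltrBrDr => /FBp_usc.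
  by apply: filterS => y; rewrite -ltrBrDr.
rewrite (@integral_cc_oc _ _ h _ (fun a => hausdorff (cut u a) (cut uh a))).
- congr (_ `^ _)%E; apply: eq_integral => a /set_mem /=; rewrite in_itv/= => /andP[ha a1].
  by rewrite cuth hdE//; apply: FBp_cut_nb; apply/andP; split; lra.
- by apply: measurable_hausdorff_cut => //; exact: FBp_usc.
- by move=> a /andP[ha a1]; rewrite cuth !fuzzy_cutE//; lra.
Qed.

Lemma left_osc_nondecreasing u h k a : 0 <= h -> h <= k < a -> a <= 1 ->
  left_osc u h a <= left_osc u k a.
Proof.
move=> h0 /andP[hk ka] a1.
by apply: hd_subset; [apply: FBp_cut_nb; apply/andP; split; lra..|
  apply: cut_le; lra|apply: cut_le; lra].
Qed.

Lemma left_osc_le_radius u h a : 0 <= h < a -> a <= 1 ->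
  left_osc u h a <= radius u a + radius u (a - h).
Proof.
move=> /andP[h0 ha] a1.
have a01 : 0 < a <= 1 by apply/andP; split; lra.
have ah01 : 0 < a - h <= 1 by apply/andP; split; lra.
rewrite !radiusE// [X in _ + X]hdC.
by apply: hd_triangle; [exact: FBp_cut_nb|exact: nonempty_bounded_set1|exact: FBp_cut_nb].
Qed.

(** Left-continuity of the cuts at a fixed level, by compactness of the cut at [a / 2]: a point of
    it with [u y < a] has a neighbourhood on which [u] stays below [a - h] for all small [h], and
    the remaining points already lie in the cut at [a]. *)
Lemma left_osc_small u a e : 0 < a <= 1 -> 0 < e ->
  exists2 d, 0 < d < a & forall h, 0 <= h <= d -> left_osc u h a <= e.
Proof.
move=> /[dup] a01 /andP[a0 a1] e0.
have a201 : 0 < a / 2 <= 1 by apply/andP; split; lra.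
have /compact_near_coveringP cK := FBp_cut_compact p1 (u := u) a201.
have /cK : forall y, cut u (a / 2) y -> \forall y' \near y & h \near 0^'+,
    a - h <= u y' -> exists2 x, cut u a x & edist y' x < e.
  move=> y _; have [ay|ya] := lerP a (u y).
    exists ([set y' | edist y y' < e], setT); first by split; [exact: near_edist|exact: filterT].
    by move=> [y' h] [/= yy' _] _; exists y => //; rewrite edistC.
  have ym : u y < (u y + a) / 2 by lra.
  exists ([set y' | u y' < (u y + a) / 2], [set h | h < (a - u y) / 2]).
    by split; [exact: FBp_usc|apply: nbhs_right_lt; lra].
  by move=> [y' h] [/= uy' hy]; lra.
move=> nK.
have [d [/= dK d0 da2]] : exists d, [/\ cut u (a / 2) `<=`
    (fun y => a - d <= u y -> exists2 x, cut u a x & edist y x < e), 0 < d & d < a / 2].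
  apply: (@filter_ex _ (0^'+)); near=> d; split; near: d => //.
  - exact: nbhs_right_gt.
  - by apply: nbhs_right_lt; lra.
(* The covering is evaluated at [d] alone: for [h <= d] the cut at [a - h] lies in the one at
   [a - d], and [d < a / 2] keeps it in the compact cut at [a / 2]. *)
exists d; first by apply/andP; split; lra.
move=> h /andP[h0 hd_]; apply/hd_le.
- exact: FBp_cut_nb.
- by apply: FBp_cut_nb; apply/andP; split; lra.
split; first by apply: within_dist_sub; [exact: ltW|apply: cut_le; lra].
move=> y; rewrite /cut /= => ahy e' e'0.
have [||x ax yx] := dK y; rewrite /cut /=; [lra|lra|].
by exists x => //; lra.
Unshelve. all: by end_near. Qed.

Lemma Lp_on_left_osc_small u (T e : R) : 0 < T <= 1 -> 0 < e ->
  exists2 d, 0 < d < T & (Lp_on p `]T, 1%R] (left_osc u d) <= e%:E)%E.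
Proof.
(* With [t = T / 2] and shifts [d n <= t], both [a] and [a - d n] stay above [t] for [a > T], so the
   constant [2 * radius u t] dominates the oscillations. *)
move=> /andP[T0 T1] e0; pose t := T / 2; pose d n := t / n.+1%:R.
have t01 : 0 < t <= 1 by rewrite /t; apply/andP; split; lra.
have t0 : 0 < t by case/andP: t01.
have d_gt0 n : 0 < d n by rewrite divr_gt0.
have d_le n : d n <= t by rewrite ler_pdivrMr// ler_peMr ?ler1n// ltW.
have tT : t < T by rewrite /t; lra.
pose f n a := ((left_osc u (d n) a)%:E `^ p)%E.
pose c := 2 * radius u t.
have c0 : 0 <= c by rewrite mulr_ge0// radius_ge0.
have osc_le n a : T < a <= 1 -> 0 <= left_osc u (d n) a <= c.
  move=> /andP[Ta a1]; have dn := d_le n; have dn0 := d_gt0 n.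
  rewrite left_osc_ge0 ?a1 ?(lt_trans T0)//=.
  apply: le_trans (left_osc_le_radius u _ a1) _; first by apply/andP; split; lra.
  have ra : radius u a <= radius u t by apply: radius_nonincreasing => //; rewrite a1 andbT; lra.
  have rad : radius u (a - d n) <= radius u t.
    by apply: radius_nonincreasing => //; rewrite /t in dn *; apply/andP; split; lra.
  by rewrite /c; lra.
have cvg_f : (\int[mu]_(a in `]T, 1%R]) f n a @[n --> \oo] -->
    \int[mu]_(a in `]T, 1%R]) cst 0 a)%E.
  have [] // := @dominated_convergence _ _ _ mu `]T, 1]%classic (measurable_itv _)
    f (cst 0%E) (cst (c `^ p)%:E).
  - by move=> n; apply: measurable_pow; exact: measurable_left_osc.
  - apply: aeW => a /=; rewrite in_itv/= => /andP[Ta a1].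
    apply: cvg_EFin; first exact: nearW.
    apply/cvgrPdist_le => r r0.
    have a01 : 0 < a <= 1 by rewrite a1 (lt_trans T0).
    have rp0 : 0 < r `^ p^-1 by rewrite powR_gt0.
    have [s /andP[s0 sa] sr] := left_osc_small u a01 rp0.
    have st0 : 0 < s / t by rewrite divr_gt0.
    have := near_infty_natSinv_lt (PosNum st0); apply: filterS => n /= nst.
    rewrite sub0r normrN ger0_norm ?powR_ge0//.
    have -> : r = (r `^ p^-1) `^ p by rewrite -powRrM mulVf// powRr1// ltW.
    rewrite ge0_ler_powR ?nnegrE ?(ltW p0) ?(ltW rp0) ?left_osc_ge0//.
    apply: sr; rewrite (ltW (d_gt0 n))/=.
    by move: nst; rewrite ltr_pdivlMr// mulrC => /ltW.
  - apply/integrableP; split; first exact: measurable_cst.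
    rewrite (integral_cst mu)//= lebesgue_measure_itv/= lte_fin.
    by case: ifP => _; rewrite ?mule0// -EFinD -EFinM ltry.
  - apply: aeW => a n /=; rewrite in_itv/= => Ta1.
    rewrite lee_fin ger0_norm ?powR_ge0//.
    have /andP[os0 osc] := osc_le n a Ta1.
    by rewrite ge0_ler_powR ?nnegrE// ltW.
have ep0 : (0 < (e `^ p)%:E)%E by rewrite lte_fin powR_gt0.
have : nbhs (\int[mu]_(a in `]T, 1%R]) cst 0 a)%E [set x : \bar R | (x < (e `^ p)%:E)%E].
  rewrite integral0; apply: open_nbhs_nbhs; split => //.
  exact: open_ereal_lt_ereal.
move=> /cvg_f [N _ /(_ N (leqnn N))/= fN]; exists (d N).
  by rewrite d_gt0/= (le_lt_trans (d_le N)).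
by apply/Lp_on_leP => //; exact: ltW.
Qed.

Lemma in_itv_setU a b c : a <= b <= c ->
  `]a, c]%classic = `]a, b]%classic `|` `]b, c]%classic.
Proof.
move=> /andP[ab bc]; apply/seteqP; split => x /=; rewrite !in_itv/=.
  move=> /andP[ax xc]; have [xb|bx] := lerP x b; [left|right];
    by apply/andP; split.
move=> [/andP[ax xb]|/andP[bx xc]]; apply/andP; split => //.
  exact: le_trans bc.
exact: le_lt_trans bx.
Qed.

(** On []h, T]] the oscillation is at most [radius u a + radius u (a - h)], and both p-means are
    tails of the radius inside []0, T]], the second after translation. On []T, 1]] it increases with
    the shift, so a bound at one shift [d] serves all smaller ones. These three terms cost [e / 4]
    each. *)
Lemma FBp_equi_left_continuous u (e : R) : 0 < e ->
  exists2 d, 0 < d < 1 & forall h, 0 <= h < d -> (Lp_left_osc u h < e%:E)%E.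
Proof.
move=> e0; have e40 : 0 < e / 4 by rewrite divr_gt0.
have [|T /andP[T0 T1] rT] := Lp_on_tail p1 (measurable_radius u (D := _)) _ e40.
  by have := dp_fin p1 u (FBp0 p1); rewrite (dpE p1).
have [|d /andP[d0 dT] od] := @Lp_on_left_osc_small u T (e / 4) _ e40.
  by rewrite T0.
exists d; first by rewrite d0 (lt_le_trans dT).
move=> h /andP[h0 hd_].
have near0 : (Lp_on p `]h, T] (left_osc u h) <= (e / 4 + e / 4)%:E)%E.
  rewrite EFinD; apply: (@le_trans _ _ (Lp_on p `]h, T] (radius u) +
      Lp_on p `]h, T] (fun a => radius u (a - h)%R))%E).
    apply: Lp_on_minkowski => //.
    - exact: measurable_radius.
    - exact: measurable_hd_FBp.
    - exact: measurable_left_osc.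
    - move=> a /=; rewrite in_itv/= => /andP[ha aT].
      by rewrite radius_ge0//; apply/andP; split; lra.
    - move=> a /=; rewrite in_itv/= => /andP[ha aT].
      by rewrite radius_ge0//; apply/andP; split; lra.
    - move=> a /=; rewrite in_itv/= => /andP[ha aT].
      rewrite left_osc_ge0/= ?left_osc_le_radius ?h0//; first lra.
      by apply/andP; split; lra.
  have sub s r : 0 <= s -> r <= T -> (Lp_on p `]s, r] (radius u) <= (e / 4)%:E)%E.
    move=> s0 rT'; apply: le_trans (ltW rT); apply: le_Lp_on => //.
    - by move=> a /=; rewrite !in_itv/= => /andP[sa ar]; apply/andP; split; lra.
    - exact: measurable_radius.
    - exact: measurable_radius.
    - move=> a /=; rewrite in_itv/= => /andP[sa ar]; rewrite lexx andbT.
      by rewrite radius_ge0//; apply/andP; split; lra.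
  apply: leeD; first exact: sub.
  have -> : `]h, T]%classic = `]0 + h, (T - h) + h]%classic by rewrite add0r subrK.
  rewrite Lp_on_shift; last exact: measurable_radius.
  by apply: sub => //; lra.
have away : (Lp_on p `]T, 1%R] (left_osc u h) <= (e / 4)%:E)%E.
  apply: le_trans od; apply: le_Lp_on => //.
  - exact: measurable_left_osc.
  - exact: measurable_left_osc.
  - move=> a /=; rewrite in_itv/= => /andP[Ta a1].
    rewrite left_osc_ge0 ?left_osc_nondecreasing//; first by apply/andP; split; lra.
    by apply/andP; split; lra.
rewrite /Lp_left_osc (@in_itv_setU h T 1); last by apply/andP; split; lra.
apply: (@le_lt_trans _ _ (e / 4 + e / 4 + e / 4)%:E); last by rewrite lte_fin; lra.
rewrite EFinD; apply: le_trans (leeD near0 away); apply: Lp_on_setU => //.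
- exact: measurable_left_osc.
- move=> a; rewrite -in_itv_setU; last by apply/andP; split; lra.
  by rewrite /= in_itv/= => /andP[ha a1]; apply: left_osc_ge0; rewrite a1 (le_lt_trans h0).
Qed.

(* Comparing the levels in [`]0, t]] with those in [`]s, s + t]] bounds the
   contribution of low levels uniformly over an equi-left-continuous family. *)
Lemma Lp_on_radius_low u (s t : R) : 0 < s -> 0 < t -> s + t <= 1 ->
  (Lp_on p `]0%R, t] (radius u) <=
   Lp_left_osc u s + (radius u s * t `^ p^-1)%:E)%E.
Proof.
move=> s0 t0 st1.
apply: (@le_trans _ _ (Lp_on p `]0%R, t] (fun a => left_osc u s (a + s)%R) +
    Lp_on p `]0%R, t] (cst (radius u s)))%E).
  apply: Lp_on_minkowski => //.
  - have := measurable_hd_FBp u u (D := `]0, t]%classic) (- s) 0.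
    by apply: eq_measurable_fun => a _; rewrite /left_osc opprK addrK subr0.
  - exact: measurable_radius.
  - move=> a /=; rewrite in_itv/= => /andP[a0 at_].
    by apply: left_osc_ge0; apply/andP; split; lra.
  - by move=> a _; apply: radius_ge0; apply/andP; split; lra.
  - move=> a /=; rewrite in_itv/= => /andP[a0 at_].
    have a01 : 0 < a <= 1 by apply/andP; split; lra.
    have as01 : 0 < a + s <= 1 by apply/andP; split; lra.
    rewrite radius_ge0//=.
    apply: (@le_trans _ _ (left_osc u s (a + s) + radius u (a + s))).
      rewrite !radiusE// /left_osc addrK [X in X + _]hdC.
      by apply: hd_triangle; [exact: FBp_cut_nb..|exact: nonempty_bounded_set1].
    by rewrite lerD2l; apply: radius_nonincreasing => //; apply/andP; split; lra.
rewrite Lp_on_cst ?(ltW t0)//; last by apply: radius_ge0; apply/andP; split; lra.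
rewrite subr0; apply: leeD2r.
have -> : Lp_on p `]0%R, t] (fun a => left_osc u s (a + s)) =
    Lp_on p `]0 + s, t + s] (left_osc u s).
  rewrite -(@Lp_on_shift _ p 0 t s (fun a => left_osc u s (a + s))).
    by apply: eq_Lp_on => a _; rewrite subrK.
  have := measurable_hd_FBp u u (D := `]0, t]%classic) (- s) 0.
  by apply: eq_measurable_fun => a _; rewrite /left_osc opprK addrK subr0.
apply: le_Lp_on => //.
- by move=> a /=; rewrite !in_itv/= => /andP[sa ast]; apply/andP; split; lra.
- exact: measurable_left_osc.
- exact: measurable_left_osc.
- move=> a /=; rewrite in_itv/= => /andP[sa ast]; rewrite lexx andbT.
  by apply: left_osc_ge0; apply/andP; split; lra.
Qed.

End left_oscillation.

(** * The topology of [dp]; compact sets are bounded and equi-left-continuous *)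

Section dp_topology.
Context {R : realType} {m : nat} {p : R}.
Hypothesis p1 : 1 <= p.
Implicit Types (u v w : FBp m p) (U : set (FBp m p)).

Lemma dp_lt_triangle v u w (r s : R) :
  (dp p u v < r%:E)%E -> (dp p v w < s%:E)%E -> (dp p u w < (r + s)%:E)%E.
Proof.
move=> uv vw; apply: le_lt_trans (dp_triangle p1 v u w) _.
by rewrite EFinD; exact: lteD.
Qed.

Lemma dp_ball_nbhs u (e : R) : 0 < e -> nbhs u [set v : FBp m p | (dp p u v < e%:E)%E].
Proof.
move=> e0; apply: open_nbhs_nbhs; split; last by rewrite /= dpxx ?lte_fin.
move=> v uv; have uv_fin : dp p u v \is a fin_num.
  by rewrite ge0_fin_numE ?dp_ge0//; exact: lt_trans uv (ltry _).
exists (e - fine (dp p u v)).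
  by rewrite subr_gt0 -lte_fin fineK.
move=> w vw; apply: le_lt_trans (dp_triangle p1 v u w) _.
have -> : e%:E = (dp p u v + (e - fine (dp p u v))%:E)%E.
  by rewrite -{1}(fineK uv_fin) -EFinD addrC subrK.
by rewrite lteD2lE.
Qed.

Lemma nbhs_dp_ball u (A : set (FBp m p)) : nbhs u A ->
  exists2 e, 0 < e & forall v, (dp p u v < e%:E)%E -> A v.
Proof.
rewrite nbhsE => -[B [oB Bu] BA].
have [e e0 eB] : exists2 e : R, 0 < e & forall v, (dp p u v < e%:E)%E -> B v by exact: oB.
by exists e => // v /eB/BA.
Qed.

Lemma FBp_hausdorff : hausdorff_space (FBp m p).
Proof.
move=> u v uv; apply: (dp_eq0 p1); apply/le_anti/andP; split; last exact: dp_ge0.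
apply/lee_addgt0Pr => e e0; rewrite add0e.
have e20 : 0 < e / 2 by rewrite divr_gt0.
have [w [uw vw]] := uv _ _ (dp_ball_nbhs u e20) (dp_ball_nbhs v e20).
rewrite [X in X%:E](splitr e); apply: ltW; apply: (dp_lt_triangle uw).
by rewrite dp_sym.
Qed.

(** Compactness is used in its near-covering form with parameter [M] tending to [+oo]; on a unit
    ball the distance to [FBp0] grows by at most [1]. *)
Lemma compact_p_mean_bounded U : compact U -> p_mean_bounded U.
Proof.
move=> /compact_near_coveringP cU.
have /cU : forall u, U u -> \forall u' \near u & M \near pinfty_nbhs R,
    (dp p (u' : FBp m p) (FBp0 p1) <= M%:E)%E.
  move=> u _; have u0_fin : dp p u (FBp0 p1) \is a fin_num.
    by rewrite ge0_fin_numE ?dp_ge0//; exact: dp_fin.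
  exists ([set v : FBp m p | (dp p u v < 1%:E)%E], [set M | 1 + fine (dp p u (FBp0 p1)) < M]).
    split; first exact: dp_ball_nbhs.
    by apply: nbhs_pinfty_gt; exact: num_real.
  move=> [v M] [/= uv uM]; apply: le_trans (dp_triangle p1 u v (FBp0 p1)) _.
  apply: le_trans (_ : (1 + fine (dp p u (FBp0 p1)))%:E <= _)%E.
    by rewrite EFinD (fineK u0_fin); apply: leeD2r; rewrite (dp_sym p1); exact: ltW.
  by rewrite lee_fin ltW.
move=> nU; have [M [UM M0]] : exists M : R,
    (U `<=` (fun u : FBp m p => (dp p u (FBp0 p1) <= M%:E)%E)) /\ 0 < M.
  apply: (@filter_ex _ (pinfty_nbhs R)); near=> M; split; near: M; first exact: nU.
  by apply: nbhs_pinfty_gt; exact: num_real.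
by exists M => // u /UM.
Unshelve. all: by end_near. Qed.

(** Triangle inequality through the cuts of [u] at [a] and [a - h]. The term at level [a - h]
    translates to an integral over []0, 1 - h]], so both detours cost at most the distance. *)
Lemma Lp_left_osc_le u v (h : R) : 0 <= h ->
  (Lp_left_osc v h <= dp p v u + (Lp_left_osc u h + dp p u v))%E.
Proof.
move=> h0; set f := fun a => level_dist u v (a - h).
have mf D : measurable_fun D f by exact: measurable_hd_FBp.
have h1 a : a \in `]h, 1] -> 0 < a <= 1 /\ 0 < a - h <= 1.
  by rewrite in_itv/= => /andP[ha a1]; split; apply/andP; split; lra.
apply: (@le_trans _ _ (Lp_on p `]h, 1%R] (level_dist v u) +
    (Lp_left_osc u h + Lp_on p `]h, 1%R] f))%E).
  apply: (Lp_on_minkowski3 p1) => //.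
  - exact: measurable_level_dist.
  - exact: measurable_left_osc.
  - exact: measurable_left_osc.
  - by move=> a /h1[a01 _]; exact: level_dist_ge0.
  - by move=> a /h1[a01 _]; exact: left_osc_ge0.
  - by move=> a /h1[_ ah01]; exact: level_dist_ge0.
  move=> a /h1[a01 ah01]; rewrite (left_osc_ge0 p1)//=.
  have nb w b : 0 < b <= 1 -> nonempty_bounded (cut w b).
    exact: FBp_cut_nonempty_bounded.
  apply: le_trans (_ : level_dist v u a + hd (cut u a) (cut v (a - h)) <= _).
    by apply: hd_triangle; exact: nb.
  by rewrite lerD2l; apply: hd_triangle; exact: nb.
apply: leeD; last apply: leeD.
- rewrite (dpE p1); apply: (le_Lp_on p1); [exact: measurable_itv..| | | |].
  + by move=> a /= /h1[]; rewrite in_itv.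
  + exact: measurable_level_dist.
  + exact: measurable_level_dist.
  + by move=> a /h1[a01 _]; rewrite lexx andbT; exact: level_dist_ge0.
- exact: lexx.
have -> : `]h, 1]%classic = `]0 + h, (1 - h) + h]%classic by rewrite add0r subrK.
rewrite (Lp_on_shift p h (measurable_level_dist u v (D := _))).
rewrite (dpE p1); apply: (le_Lp_on p1); [exact: measurable_itv..| | | |].
+ by move=> a /=; rewrite !in_itv/= => /andP[a0 a1]; apply/andP; split; lra.
+ exact: measurable_level_dist.
+ exact: measurable_level_dist.
+ move=> a /=; rewrite in_itv/= => /andP[a0 a1]; rewrite lexx andbT.
  by apply: (level_dist_ge0 p1); apply/andP; split; lra.
Qed.

(** By [Lp_left_osc_le] the bound [e / 4] at [u] becomes [3 * e / 4] on its [e / 4]-ball, for the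
    same shifts; the near-covering parameter is [d] tending to [0] from the right. *)
Lemma compact_p_mean_equi_left_continuous U :
  compact U -> p_mean_equi_left_continuous U.
Proof.
move=> /compact_near_coveringP cU e e0; have e40 : 0 < e / 4 by rewrite divr_gt0.
have /cU : forall u, U u -> \forall u' \near u & d \near (0 : R)^'+,
    forall h, 0 <= h < d -> (Lp_left_osc u' h < e%:E)%E.
  move=> u _; have [d /andP[d0 d1] ud] := FBp_equi_left_continuous p1 u e40.
  exists ([set v : FBp m p | (dp p u v < (e / 4)%:E)%E], [set d' | d' < d]).
    by split; [exact: dp_ball_nbhs|exact: nbhs_right_lt].
  move=> [v d'] [/= uv d'd] h /andP[h0 hd']; apply: le_lt_trans (Lp_left_osc_le u v h0) _.
  apply: (@lt_le_trans _ _ (e / 4 + (e / 4 + e / 4))%:E).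
    rewrite !EFinD; apply: lteD; first by rewrite dp_sym.
    by apply: lteD uv; apply: ud; rewrite h0 (lt_trans hd').
  by rewrite lee_fin; lra.
move=> nU; have [d [Ud d0]] : exists d : R,
    (U `<=` (fun u => forall h, 0 <= h < d -> (Lp_left_osc u h < e%:E)%E)) /\ 0 < d.
  apply: (@filter_ex _ ((0 : R)^'+)); near=> d; split; near: d; first exact: nU.
  exact: nbhs_right_gt.
exists d => // h /[dup] hd /andP[h0 _] u Uu; rewrite (left_oscE p1)//; exact: Ud.
Unshelve. all: by end_near. Qed.

End dp_topology.

Lemma powR_le1 (R : realType) (x r : R) : 0 <= x <= 1 -> 0 <= r -> x `^ r <= 1.
Proof.
move=> /andP[x0 x1] r0; apply: (@le_trans _ _ (1 `^ r)); last by rewrite powR1.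
by rewrite ge0_ler_powR ?nnegrE.
Qed.

(** * The limit of a bounded family along an ultrafilter *)

Section ultrafilter_limit.
Context {R : realType} {m : nat} {p : R}.
Hypothesis p1 : 1 <= p.
Implicit Types (u v w : FBp m p) (a b c s e r : R) (x y : 'rV[R]_m).
Variables (F : set_system (FBp m p)) (U : set (FBp m p)).
Hypothesis FF : UltraFilter F.
Hypothesis FU : F U.
Variable M : R.
Hypothesis M0 : 0 < M.
Hypothesis UM : forall u, U u -> (dp p u (FBp0 p1) <= M%:E)%E.

Let p0 : 0 < p. Proof. exact: lt_le_trans p1. Qed.

Let F_proper : ProperFilter F. Proof. exact: ultra_proper. Qed.

Let FBp_cut_nb u a : 0 < a <= 1 -> nonempty_bounded (cut u a).
Proof. exact: FBp_cut_nonempty_bounded. Qed.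

Definition radius_bound a : R := M / a `^ p^-1.

Lemma radius_bound_ge0 a : 0 <= radius_bound a.
Proof. by rewrite divr_ge0 ?powR_ge0// ltW. Qed.

Lemma radius_le_bound u a : U u -> 0 < a <= 1 -> radius p1 u a <= radius_bound a.
Proof.
move=> Uu /[dup] a01 /andP[a0 a1]; rewrite ler_pdivlMr ?powR_gt0// -lee_fin.
by apply: le_trans (UM Uu); exact: radius_dp.
Qed.

(** The Kuratowski lower limit of the cuts along [F]; since [F] is an ultrafilter, it is also the
    upper limit. *)
Definition limit_cut a : set 'rV[R]_m :=
  [set x | forall e, 0 < e -> \forall u \near F, exists2 y, cut (u : FBp m p) a y & edist x y < e].

Lemma limit_cut_le a b : a <= b -> limit_cut b `<=` limit_cut a.
Proof.
move=> ab x bx e /bx; apply: filterS => u [y yb xy]; exists y => //.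
exact: cut_le yb.
Qed.

Lemma limit_cut_closed a : closed (limit_cut a).
Proof.
apply: closed_edist => x xa; apply: contrapT => near_x; apply: xa => e e0.
have e20 : 0 < e / 2 by rewrite divr_gt0.
have [y xy ya] : exists2 y, edist x y < e / 2 & limit_cut a y.
  apply: contrapT => no_y; apply: near_x; exists (e / 2) => // y xy ya.
  by apply: no_y; exists y.
have := ya _ e20; apply: filterS => u [z za yz]; exists z => //.
by rewrite [e]splitr; exact: edist_lt_triangle xy yz.
Qed.

Lemma limit_cut_bounded a x : 0 < a <= 1 -> limit_cut a x ->
  edist x 0 <= radius_bound a + 1.
Proof.
move=> a01 ax; have [u [Uu [y ya xy]]] := filter_ex (filterI FU (ax _ ltr01)).
have y0 := le_trans (edist0_le_radius p1 a01 ya) (radius_le_bound Uu a01).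
by have := edist_triangle y x 0; lra.
Qed.

(** Each limit point is approximated by definition; compactness of [limit_cut a] makes this uniform
    in the point. *)
Lemma limit_cut_within_cut a e : 0 < a <= 1 -> 0 < e ->
  \forall u \near F, within_dist (limit_cut a) (cut (u : FBp m p) a) e.
Proof.
move=> a01 e0; have e20 : 0 < e / 2 by rewrite divr_gt0.
have /compact_near_coveringP cK : compact (limit_cut a).
  apply: edist_bounded_compact; first exact: limit_cut_closed.
  by move=> x; exact: limit_cut_bounded.
have /cK : forall x, limit_cut a x -> \forall x' \near x & u \near F,
    exists2 y, cut (u : FBp m p) a y & edist x' y < e.
  move=> x ax.
  exists ([set x' | edist x x' < e / 2],
    [set u : FBp m p | exists2 y, cut u a y & edist x y < e / 2]).
    by split; [exact: near_edist|exact: ax].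
  move=> [x' u] [/= xx' [y ya xy]]; exists y => //.
  by rewrite [e]splitr; apply: edist_lt_triangle xy; rewrite edistC.
apply: filterS => u uK x /uK[y ya xy] e' e'0; exists y => //.
by rewrite (lt_trans xy)// ltrDl.
Qed.

(** A point outside the limit has a ball that the cuts do not meet for [F]-many [u]; as [F] is an
    ultrafilter, [F]-many cuts then miss this ball. Compactness of the ball of radius
    [radius_bound a], which contains the cuts of all [u] in [U], makes this uniform. *)
Lemma cut_within_limit_cut a e : 0 < a <= 1 -> 0 < e ->
  \forall u \near F, within_dist (cut (u : FBp m p) a) (limit_cut a) e.
Proof.
move=> a01 e0.
have /compact_near_coveringP cB :
    compact [set y : 'rV[R]_m | edist y 0 <= radius_bound a].
  by apply: edist_bounded_compact; [exact: edist_ball_closed|move=> y; exact].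
have /cB : forall y, edist y 0 <= radius_bound a -> \forall y' \near y & u \near F,
    cut (u : FBp m p) a y' -> exists2 x, limit_cut a x & edist y' x < e.
  move=> y _; have [ya|ya] := pselect (limit_cut a y).
    exists ([set y' | edist y y' < e], setT).
      by split; [exact: near_edist|exact: filterT].
    by move=> [y' u] [/= yy' _] _; exists y => //; rewrite edistC.
  have [d d0 yd] : exists2 d, 0 < d &
      ~ \forall u \near F, exists2 z, cut (u : FBp m p) a z & edist y z < d.
    apply: contrapT => no_d; apply: ya => d d0; apply: contrapT => yd.
    by apply: no_d; exists d.
  exists ([set y' | edist y y' < d],
      ~` [set u : FBp m p | exists2 z, cut u a z & edist y z < d]).
    split; first exact: near_edist.
    by have [] := in_ultra_setVsetC
      [set u : FBp m p | exists2 z, cut u a z & edist y z < d] FF.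
  by move=> [y' u] [/= yy' nu] uy'; exfalso; apply: nu; exists y'.
move=> nB; apply: filterS2 FU nB => u Uu uB y yu e' e'0.
have [|x xa yx] := uB y _ yu.
  by apply: le_trans (edist0_le_radius p1 a01 yu) _; exact: radius_le_bound.
by exists x => //; rewrite (lt_trans yx)// ltrDl.
Qed.

Lemma limit_cut_nonempty a : 0 < a <= 1 -> limit_cut a !=set0.
Proof.
move=> a01; have [u uK] := filter_ex (cut_within_limit_cut a01 ltr01).
have [[x xa] _] := FBp_cut_nb u a01.
by have [y ya _] := uK x xa 1 ltr01; exists y.
Qed.

(** The level [0] keeps the set nonempty, so that [sup] takes the value [0] off all limit cuts. *)
Let limit_levels x : set R := [set b | b = 0 \/ (0 < b <= 1 /\ limit_cut b x)].

(* The cut of [limit_fun] at [a] is [\bigcap_(b < a) limit_cut b]; it can be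
   larger than [limit_cut a], whose dependence on [a] need not be left-continuous. *)
Definition limit_fun x : R := sup (limit_levels x).

Let limit_levels_has_sup x : has_sup (limit_levels x).
Proof.
split; first by exists 0; left.
by exists 1 => b [->|[/andP[]]].
Qed.

Let limit_fun_ub x b : 0 < b <= 1 -> limit_cut b x -> b <= limit_fun x.
Proof. by move=> b01 bx; apply: ub_le_sup; [case: (limit_levels_has_sup x)|right]. Qed.

Lemma limit_fun_itv x : 0 <= limit_fun x <= 1.
Proof.
have [S0 S1] := limit_levels_has_sup x; apply/andP; split.
  by apply: ub_le_sup => //; left.
by apply: ge_sup => // b [->|[/andP[]]].
Qed.

(** With [limit_cut_sub] this places [cut limit_fun a] between [limit_cut a] and [limit_cut b] for
    [0 < b < a <= 1]. *)
Lemma limit_cut_limit_fun a b x : 0 < b -> b < a -> a <= limit_fun x ->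
  limit_cut b x.
Proof.
move=> b0 ba ax; have bx : b < sup (limit_levels x) by exact: lt_le_trans ax.
have [c [c_0|[_ cx]] bc] := sup_gt (limit_levels_has_sup x).1 bx.
  by move: bc; rewrite c_0 ltNge ltW.
by apply: limit_cut_le cx; exact: ltW.
Qed.

Lemma limit_cut_sub a : 0 < a <= 1 -> limit_cut a `<=` cut limit_fun a.
Proof. by move=> a01 x ax; exact: limit_fun_ub. Qed.

Lemma limit_fun_normal : exists x, limit_fun x = 1.
Proof.
have h1 : 0 < (1 : R) <= 1 by rewrite ltr01 lexx.
have [x x1] := limit_cut_nonempty h1; exists x; apply/le_anti/andP.
by split; [case/andP: (limit_fun_itv x)|exact: limit_fun_ub].
Qed.

(** For a level [c] strictly between [limit_fun x] and [a], the closed set [limit_cut c] misses [x],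
    hence a neighbourhood of [x], where [limit_fun] is then below [a]. The case [a > 1] is separate
    because limit cuts are considered at levels up to [1]. *)
Lemma limit_fun_usc : upper_semicontinuous limit_fun.
Proof.
move=> x a xa; have /andP[x0 _] := limit_fun_itv x.
have [a1|a1] := ltrP 1 a.
  by near=> y; case/andP: (limit_fun_itv y) => _ /le_lt_trans; exact.
pose b := (limit_fun x + a) / 2; pose c := (limit_fun x + b) / 2.
have [xc cb ba] : [/\ limit_fun x < c, c < b & b < a] by rewrite /c /b; split; lra.
have xKc : (~` limit_cut c) x.
  have c01 : 0 < c <= 1 by apply/andP; split; lra.
  by move=> cx; have := limit_fun_ub c01 cx; rewrite leNgt xc.
have oKc : open (~` limit_cut c) by apply: closed_openC; exact: limit_cut_closed.
have : \forall y \near x, (~` limit_cut c) y by apply: open_nbhs_nbhs; split.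
apply: filterS => y yc; rewrite ltNge; apply/negP => ay; apply: yc.
by apply: limit_cut_limit_fun ay; lra.
Unshelve. all: by end_near. Qed.

Lemma limit_fun_cut_nb a : 0 < a <= 1 -> nonempty_bounded (cut limit_fun a).
Proof.
move=> /andP[a0 a1]; have [x x1] := limit_fun_normal; split.
  by exists x; rewrite /cut /= x1.
have a201 : 0 < a / 2 <= 1 by apply/andP; split; lra.
exists (radius_bound (a / 2) + 1) => y ay; apply: limit_cut_bounded => //.
by apply: limit_cut_limit_fun ay; lra.
Qed.

(* Closeness to the limit on the finite grid of multiples of [s / 2] controls
   every level above [s], up to a shift by [s]. *)
Lemma cut_limit_fun_shift s e : 0 < s -> 0 < e ->
  \forall u \near F, forall a, s < a <= 1 ->
    within_dist (cut limit_fun a) (cut (u : FBp m p) (a - s)) e /\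
    within_dist (cut (u : FBp m p) a) (cut limit_fun (a - s)) e.
Proof.
move=> s0 e0; pose h := s / 2; have h0 : 0 < h by rewrite divr_gt0.
(* The indices [k < N] include every [k] with [k%:R * h <= 1]. *)
pose N := (Num.truncn h^-1).+1.
have gridN : \forall u \near F, forall k : 'I_N, 0 < k%:R * h <= 1 ->
    within_dist (limit_cut (k%:R * h)) (cut (u : FBp m p) (k%:R * h)) e /\
    within_dist (cut (u : FBp m p) (k%:R * h)) (limit_cut (k%:R * h)) e.
  apply: filter_forall => k; have [k01|k01] := boolP (0 < k%:R * h <= 1).
    by apply: filterS2 (limit_cut_within_cut k01 e0) (cut_within_limit_cut k01 e0).
  by apply: filterE => u.
apply: filterS gridN => u grid a /andP[sa a1].
(* Rounding down [a - h / 2] instead of [a] makes [c < a] strict, as [limit_cut_limit_fun] requires,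
   while [c > a - 3 * h / 2] still gives [c >= a - s] and [c > 0], because [a > s = 2 * h]. *)
pose k := Num.truncn ((a - h / 2) / h); pose c := k%:R * h.
have /andP[kle klt] : k%:R <= (a - h / 2) / h < k.+1%:R.
  by apply: truncn_itv; rewrite divr_ge0 ?(ltW h0)//; rewrite /h; lra.
have ca : c <= a - h / 2 by rewrite -ler_pdivlMr.
have ac : a - h / 2 < c + h.
  by move: klt; rewrite ltr_pdivrMr// -[k.+1%:R]natr1 mulrDl mul1r.
have [asc ca'] : a - s <= c /\ c < a by split; rewrite /h in ca ac *; lra.
have c01 : 0 < c <= 1 by apply/andP; split; lra.
have kN : (k < N)%N.
  by rewrite ltnS; apply: le_truncn; rewrite ler_pdivrMr// mulVf ?gt_eqF//; lra.
have [Kc cK] := grid (Ordinal kN) c01; split.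
  apply: within_distS Kc; last by apply: cut_le.
  by move=> x; apply: limit_cut_limit_fun; case/andP: c01.
apply: within_distS cK; first by apply: cut_le; exact: ltW.
by apply: subset_trans (limit_cut_sub c01) _; exact: cut_le.
Qed.

(** Above a level [t], one [u] in [U] close to the limit up to the shift [t / 2] bounds the radius
    of the limit at [a] by [1 + radius p1 u (a - t / 2)]. The resulting bound [1 + M] does not
    depend on [t], although [u] does, and [Lp_on_exhaust] removes [t]. *)
Lemma limit_fun_Lp :
  ((\int[lebesgue_measure]_(alpha in `[0%R, 1%R])
     (hausdorff (fuzzy_cut limit_fun alpha) [set 0%R] `^ p)) `^ p^-1 < +oo)%E.
Proof.
pose f a := hd (cut limit_fun a) (cut (FBp0 p1 : FBp m p) a).
have mf D : measurable_fun D f.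
  by apply: measurable_hd_cut; [exact: limit_fun_usc|exact: FBp_usc].
rewrite (Lp_indic0 limit_fun_usc) (dp_oc limit_fun_usc indic0_usc).
rewrite [X in (X `^ _ < _)%E](_ : _ =
    \int[lebesgue_measure]_(a in `]0%R, 1%R]) ((f a)%:E `^ p))%E; last first.
  apply: eq_integral => a /set_mem /=; rewrite in_itv/= => a01.
  rewrite hdE//; first exact: limit_fun_cut_nb.
  exact: (FBp_cut_nb (FBp0 p1) a01).
rewrite -/(Lp_on p _ f); apply: le_lt_trans (ltry (1 + M)).
apply: (Lp_on_exhaust p1) => //; first by rewrite addr_ge0// ltW.
move=> t /andP[t0 t1]; pose s := t / 2; have s0 : 0 < s by rewrite divr_gt0.
have st : s < t by rewrite /s; lra.
have [u [Uu uf]] := filter_ex (filterI FU (cut_limit_fun_shift s0 ltr01)).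
apply: (@le_trans _ _ (Lp_on p `]t, 1%R] (cst 1%R) +
    Lp_on p `]t, 1%R] (fun a => radius p1 u (a - s)%R))%E).
  apply: (Lp_on_minkowski p1) => //.
  - exact: measurable_hd_FBp.
  - move=> a /=; rewrite in_itv/= => /andP[ta a1].
    by apply: radius_ge0; apply/andP; split; lra.
  - move=> a /=; rewrite in_itv/= => /andP[ta a1].
    have a01 : 0 < a <= 1 by apply/andP; split; lra.
    have as01 : 0 < a - s <= 1 by apply/andP; split; lra.
    have sa : s < a <= 1 by apply/andP; split; lra.
    have nb := limit_fun_cut_nb a01.
    rewrite /f cut_FBp0// hd_ge0//=; apply: hd0_le => // x xa.
    apply/ler_addgt0Pr => r r0.
    have [y ya xy] := (uf a sa).1 x xa r r0.
    have := edist0_le_radius p1 as01 ya; have := edist_triangle y x 0; lra.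
rewrite EFinD; apply: leeD.
  rewrite (Lp_on_cst p1)//; rewrite lee_fin mul1r.
  by apply: powR_le1; rewrite ?invr_ge0 ?(ltW p0)//; apply/andP; split; lra.
have -> : `]t, 1]%classic = `](t - s) + s, (1 - s) + s]%classic by rewrite !subrK.
rewrite (Lp_on_shift p s (measurable_radius p1 u (D := _))).
apply: le_trans (UM Uu); rewrite (dpE p1); apply: (le_Lp_on p1);
  [exact: measurable_itv..| | | |].
- by move=> a /=; rewrite !in_itv/= => /andP[a0 a1]; apply/andP; split; lra.
- exact: measurable_level_dist.
- exact: measurable_level_dist.
- move=> a /=; rewrite in_itv/= => /andP[a0 a1]; rewrite lexx andbT.
  by apply: radius_ge0; apply/andP; split; lra.
Qed.

Definition limit_FBp : FBp m p :=
  MkFBp limit_fun_itv limit_fun_normal limit_fun_usc limit_fun_Lp.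

Lemma level_dist_limit s e : 0 < s -> 0 < e ->
  \forall u \near F, forall a, s < a <= 1 ->
    level_dist limit_FBp u a <= e + (left_osc u s a + left_osc limit_FBp s a).
Proof.
move=> s0 e0; apply: filterS (cut_limit_fun_shift s0 e0) => u uf a /[dup] sa /andP[sa' a1].
have [wu uw] := uf a sa.
have a01 : 0 < a <= 1 by apply/andP; split; lra.
have as01 : 0 < a - s <= 1 by apply/andP; split; lra.
have [ou ow] := (left_osc_ge0 p1 u s a01, left_osc_ge0 p1 limit_FBp s a01).
have osc v : within_dist (cut v (a - s)) (cut v a) (left_osc v s a).
  by rewrite /left_osc hdC; apply: hd_within; exact: FBp_cut_nb.
apply/hd_le; [exact: FBp_cut_nb..|split].
  apply: within_dist_le (within_dist_trans wu (osc u)); lra.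
apply: within_dist_le (within_dist_trans uw (osc limit_FBp)); lra.
Qed.

Lemma uniform_low_levels (elc : p_mean_equi_left_continuous U) e : 0 < e ->
  exists2 t, 0 < t <= 1 & forall t' u, 0 < t' <= t -> U u ->
    (Lp_on p `]0%R, t'] (radius p1 u) <= e%:E)%E.
Proof.
move=> e0; have e20 : 0 < e / 2 by rewrite divr_gt0.
have [d d0 Ud] := elc _ e20.
(* [s < d] makes the oscillation small, and [s <= 1 / 2] leaves room for [s + t <= 1] with
   [t <= 1 / 2]. *)
pose s := Num.min d 1 / 2.
have dm : 0 < Num.min d 1 by rewrite lt_min d0 ltr01.
have [md m1] : Num.min d 1 <= d /\ Num.min d 1 <= 1 by split; rewrite ge_min lexx ?orbT.
have s0 : 0 < s by rewrite divr_gt0.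
have [sd s12] : s < d /\ s <= 1 / 2 by rewrite /s; split; lra.
have s01 : 0 < s <= 1 by apply/andP; split; lra.
pose r := radius_bound s; have r0 : 0 <= r := radius_bound_ge0 s.
(* [t <= q ^ p] turns the second term of [Lp_on_radius_low] into at most [r * q <= e / 2]; the
   summand [1] keeps the divisor positive. *)
pose q := e / 2 / (r + 1); have q0 : 0 < q by rewrite divr_gt0//; lra.
exists (Num.min (1 / 2) (q `^ p)).
  rewrite lt_min powR_gt0// andbT ge_min; apply/andP; split; first lra.
  by apply/orP; left; lra.
move=> t u /andP[t0]; rewrite le_min => /andP[t12 tq] Uu.
have st1 : s + t <= 1 by lra.
apply: le_trans (Lp_on_radius_low p1 u s0 t0 st1) _.
have -> : e%:E = ((e / 2)%:E + (e / 2)%:E)%E by rewrite -EFinD -splitr.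
apply: leeD.
  have sd' : 0 <= s < d by rewrite (ltW s0).
  by have := Ud s sd' u Uu; rewrite (left_oscE p1 u (ltW s0)) => /ltW.
rewrite lee_fin; have us := radius_le_bound Uu s01.
have tq' : t `^ p^-1 <= q.
  have -> : q = (q `^ p) `^ p^-1 by rewrite -powRrM mulfV ?gt_eqF// powRr1// ltW.
  by rewrite ge0_ler_powR ?nnegrE ?powR_ge0 ?invr_ge0 ?(ltW p0) ?(ltW t0).
apply: (@le_trans _ _ (r * q)).
  by apply: ler_pM => //; [exact: radius_ge0|exact: powR_ge0].
by rewrite /q mulrA ler_pdivrMr ?mulrDr; [nra|lra].
Qed.

Lemma cvg_limit_FBp : p_mean_equi_left_continuous U -> F --> limit_FBp.
Proof.
move=> elc A /nbhs_dp_ball[e e0 eA].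
(* Five terms of size [e / 8] arise: the two radii below [t], and above it the grid error and two
   oscillations. *)
have e80 : 0 < e / 8 by rewrite divr_gt0.
have [t1 /andP[t10 t11] low] := uniform_low_levels elc e80.
have [|t2 /andP[t20 t21] lowL] := Lp_on_tail p1 (measurable_radius p1 limit_FBp (D := _)) _ e80.
  by have := dp_fin p1 limit_FBp (FBp0 p1); rewrite (dpE p1).
have [d1 d10 Ud] := elc _ e80.
have [d2 /andP[d20 d21] Ld] := FBp_equi_left_continuous p1 limit_FBp e80.
pose t := Num.min t1 t2.
have [t0 tt1 tt2] : [/\ 0 < t, t <= t1 & t <= t2].
  by split; rewrite ?lt_min ?t10 ?t20// ge_min lexx ?orbT.
(* [s < t] makes the level estimate valid on all of []t, 1]]; [s < d1] and [s < d2] control the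
   oscillations of [u] and of the limit. *)
clearbody t; pose s := Num.min t (Num.min d1 d2) / 2.
have mt : 0 < Num.min t (Num.min d1 d2) by rewrite lt_min t0 lt_min d10 d20.
have s0 : 0 < s by rewrite divr_gt0.
have [st sd1 sd2] : [/\ s < t, s < d1 & s < d2].
  have h3 : [/\ Num.min t (Num.min d1 d2) <= t, Num.min t (Num.min d1 d2) <= d1 &
      Num.min t (Num.min d1 d2) <= d2] by split; rewrite !ge_min lexx ?orbT.
  by case: h3 => h31 h32 h33; split; rewrite /s; lra.
apply: filterS2 FU (level_dist_limit s0 e80) => u Uu uL; apply: eA.
have low_dist : (Lp_on p `]0%R, t] (level_dist limit_FBp u) <=
    (e / 8)%:E + (e / 8)%:E)%E.
  apply: (@le_trans _ _ (Lp_on p `]0%R, t] (radius p1 limit_FBp) +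
      Lp_on p `]0%R, t] (radius p1 u))%E).
    have t_itv a : a \in `]0, t] -> 0 < a <= 1.
      by rewrite in_itv/= => /andP[a0 at_]; apply/andP; split; lra.
    apply: (Lp_on_minkowski p1); first exact: measurable_itv.
    - exact: measurable_radius.
    - exact: measurable_radius.
    - exact: measurable_level_dist.
    - by move=> a /t_itv; exact: radius_ge0.
    - by move=> a /t_itv; exact: radius_ge0.
    - move=> a /t_itv a01; rewrite (level_dist_ge0 p1)//= /radius.
      rewrite (level_distC u (FBp0 p1)); exact: level_dist_triangle.
  apply: leeD; last by apply: low => //; rewrite t0.
  apply: le_trans (ltW lowL); apply: (le_Lp_on p1); [exact: measurable_itv..| | | |].
  - by move=> a /=; rewrite !in_itv/= => /andP[a0 at_]; apply/andP; split; lra.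
  - exact: measurable_radius.
  - exact: measurable_radius.
  - move=> a /=; rewrite in_itv/= => /andP[a0 at_]; rewrite lexx andbT.
    by apply: radius_ge0; apply/andP; split; lra.
have t_itv a : a \in `]t, 1] -> 0 < a <= 1 /\ s < a <= 1.
  by rewrite in_itv/= => /andP[ta a1]; split; apply/andP; split; lra.
have osc_le v : (Lp_left_osc v s < (e / 8)%:E)%E ->
    (Lp_on p `]t, 1%R] (left_osc v s) <= (e / 8)%:E)%E.
  move=> /ltW; apply: le_trans; apply: (le_Lp_on p1); [exact: measurable_itv..| | | |].
  - by move=> a /= /t_itv[]; rewrite in_itv.
  - exact: measurable_left_osc.
  - exact: measurable_left_osc.
  - by move=> a /t_itv[a01 _]; rewrite lexx andbT; exact: left_osc_ge0.
have high_dist : (Lp_on p `]t, 1%R] (level_dist limit_FBp u) <=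
    (e / 8)%:E + ((e / 8)%:E + (e / 8)%:E))%E.
  apply: (@le_trans _ _ (Lp_on p `]t, 1%R] (cst (e / 8)%R) +
      (Lp_on p `]t, 1%R] (left_osc u s) +
       Lp_on p `]t, 1%R] (left_osc limit_FBp s)))%E).
    apply: (Lp_on_minkowski3 p1); first exact: measurable_itv.
    - exact: measurable_cst.
    - exact: measurable_left_osc.
    - exact: measurable_left_osc.
    - exact: measurable_level_dist.
    - by move=> a _; exact: ltW.
    - by move=> a /t_itv[a01 _]; exact: left_osc_ge0.
    - by move=> a /t_itv[a01 _]; exact: left_osc_ge0.
    - move=> a /t_itv[a01 sa]; rewrite (level_dist_ge0 p1)//=; exact: uL.
  apply: leeD; last apply: leeD.
  - rewrite (Lp_on_cst p1) ?(ltW e80)//; last lra.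
    rewrite lee_fin ler_piMr ?(ltW e80)//.
    by apply: powR_le1; rewrite ?invr_ge0 ?(ltW p0)//; apply/andP; split; lra.
  - apply: osc_le; have := Ud s _ u Uu; rewrite (left_oscE p1 u (ltW s0)); apply.
    by rewrite (ltW s0).
  - by apply: osc_le; apply: Ld; rewrite (ltW s0).
rewrite (dpE p1) (@in_itv_setU _ 0 t 1); last by apply/andP; split; lra.
apply: le_lt_trans (_ : ((e / 8 + e / 8) + (e / 8 + (e / 8 + e / 8)))%:E < _)%E.
  rewrite !EFinD; apply: le_trans (leeD low_dist high_dist).
  apply: (Lp_on_setU p1); [exact: measurable_itv..|exact: measurable_level_dist|].
  move=> a; rewrite -in_itv_setU; last by apply/andP; split; lra.
  by rewrite /= in_itv/=; exact: level_dist_ge0.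
by rewrite lte_fin; lra.
Qed.

End ultrafilter_limit.

(** * The compactness criterion *)

Theorem theorem4p3 (R : realType) (m : nat) (p : R) (hm : (1 <= m)%N)
    (hp : 1 <= p) (U : set (FBp m p)) :
  compact U <->
  [/\ p_mean_bounded U, p_mean_equi_left_continuous U & closed U].
Proof.
split=> [cU|[[M M0 UM] elc clU]].
  split; [exact: compact_p_mean_bounded|exact: compact_p_mean_equi_left_continuous|].
  by apply: compact_closed cU; exact: FBp_hausdorff.
rewrite compact_ultra => F FF FU.
have cvgF := @cvg_limit_FBp R m p hp F U FF FU M M0 UM elc.
exists (@limit_FBp R m p hp F U FF FU M M0 UM); split => //.
(* Every neighbourhood of the limit belongs to [F] and hence meets [U], so the limit is in the
   closure of [U]. *)
by apply: clU => A /cvgF FA; exact: filter_ex (filterI FU FA).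
Qed.
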